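(* Let $\alpha:\mathcal B\to\mathcal B$ be a $\mathbb C$-linear map, let $\beta\in\Sigma_{alg}(\mathcal B)$, and let $\gamma_\alpha$ be the $\mathcal B$-valued semicircular distribution with covariance $\alpha$. Then $$\Phi[\beta\boxplus\gamma_\alpha]=\mathbb B_\alpha[\Phi[\beta]].$$
   Context: $\mathcal B$ is a fixed unital $C^*$-algebra. Distributions. $\mathcal B\langle \mathcal X\rangle$ is the algebra of polynomials in a formal variable $\mathcal X$ with coefficients in $\mathcal B$, where $\mathcal X$ and $\mathcal B$ are algebraically independent: as a vector space it is $\bigoplus_{n\ge 0}$ of the spans of the monomials $b_0\mathcal X b_1\cdots \mathcal X b_n$, the $n$-th span being isomorphic to $\mathcal B^{\otimes_{\mathbb C}(n+1)}$. $\Sigma_{alg}(\mathcal B)$ is the set of all $\mathbb C$-linear $\mathcal B$-bimodule maps $\mu:\mathcal B\langle\mathcal X\rangle\to\mathcal B$ with $\mu[b]=b$ for $b\in\mathcal B$. Series. $\mathrm{Ser}(\mathcal B)$ is the set of sequences $F=(F^{[n]})_{n\ge1}$ with $F^{[1]}\in\mathcal B$ and $F^{[n]}:\mathcal B^{n-1}\to\mathcal B$ $\mathbb C$-multilinear; sums are taken termwise. For linear $\alpha:\mathcal B\to\mathcal B$, $(\alpha\circ F)^{[n]}:=\alpha\circ F^{[n]}$. The moment series of $\mu\in\Sigma_{alg}(\mathcal B)$ is $M_\mu^{[1]}=\mu[\mathcal X]$, $M_\mu^{[n]}(b_1,\dots,b_{n-1})=\mu[\mathcal Xb_1\mathcal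 X\cdots b_{n-1}\mathcal X]$; $\mu\mapsto M_\mu$ is a bijection $\Sigma_{alg}(\mathcal B)\to\mathrm{Ser}(\mathcal B)$. Nested functionals. $NC(n)$ is the set of non-crossing partitions of $\{1,\dots,n\}$, and $\mathrm{Int}(n)\subseteq NC(n)$ the set of interval partitions (all blocks are intervals of consecutive integers). For $F\in\mathrm{Ser}(\mathcal B)$ and $\pi\in NC(n)$, the multilinear map $F^{[\pi]}:\mathcal B^{n-1}\to\mathcal B$ is obtained by reading the string $W_1b_1W_2b_2\cdots W_{n-1}b_{n-1}W_n$ as a parenthesized expression, where: if $m$ is the minimum of a block $V$ with $|V|=k\ge2$ then $W_m$ is ''$F^{[k]}($''; if $m$ is the maximum of a block with at least 2 elements then $W_m$ is ''$)$''; if $m\in V$ with $\min V<m<\max V$ then $W_m$ is a comma; if $\{m\}$ is a block then $W_m$ is ''$F^{[1]}$''. Example: for $\pi=\{\{1,4,5\},\{2,3\}\}$, $F^{[\pi]}(b_1,\dots,b_4)=F^{[3]}(b_1F^{[2]}(b_2)b_3,b_4)$. If $c:\pi\to\{1,2\}$ is a colouring of the blocks and $F,G\in\mathrm{Ser}(\mathcal B)$, then $(F,G)^{[\pi,c]}$ is defined by the same rule, except that blocks $V$ with $c(V)=1$ use the term $F^{[|V|]}$ and blocks with $c(V)=2$ use the term $G^{[|V|]}$. Transforms. For $\mu\in\Sigma_{alg}(\mathcal B)$, the $R$-transform $R_\mu$ and the $B$-transform $B_\mu$ are the unique series in $\mathrm{Ser}(\mathcal B)$ with $M_\mu^{[n]}=\sum_{\pi\in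 NC(n)}R_\mu^{[\pi]}$ and $M_\mu^{[n]}=\sum_{\pi\in\mathrm{Int}(n)}B_\mu^{[\pi]}$ for all $n\ge1$. Both $\mu\mapsto R_\mu$ and $\mu\mapsto B_\mu$ are bijections $\Sigma_{alg}(\mathcal B)\to\mathrm{Ser}(\mathcal B)$. Free additive convolution on $\Sigma_{alg}(\mathcal B)$ is determined by $R_{\mu\boxplus\nu}=R_\mu+R_\nu$. The semicircular distribution $\gamma_\alpha\in\Sigma_{alg}(\mathcal B)$ with variance (covariance) $\alpha$ is determined by $R_{\gamma_\alpha}^{[2]}=\alpha$ and $R_{\gamma_\alpha}^{[n]}=0$ for $n\ne2$. The maps $\widehat{\mathrm{RB}}_\alpha$ and $\mathbb B_\alpha$. For $\pi\in NC(n)$ write $\pi\ll 1_n$ if $1$ and $n$ lie in the same block of $\pi$; that block is denoted $V_o(\pi)$. Let $\mathrm o_\pi$ be the colouring of $\pi$ with $\mathrm o_\pi(V_o(\pi))=1$ and $\mathrm o_\pi(V)=2$ for all other blocks. For linear $\alpha:\mathcal B\to\mathcal B$, $\widehat{\mathrm{RB}}_\alpha:\mathrm{Ser}(\mathcal B)\to\mathrm{Ser}(\mathcal B)$ is given by $\widehat{\mathrm{RB}}_\alpha(F)^{[n]}=\sum_{\pi\in NC(n),\,\pi\ll1_n}(F,\alpha\circ F)^{[\pi,\mathrm o_\pi]}$, $n\ge1$. For $\mu\in\Sigma_{alg}(\mathcal B)$, $\mathbb B_\alpha(\mu)\in\Sigma_{alg}(\mathcal B)$ is the distribution determined by $R_{\mathbb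 B_\alpha(\mu)}=\widehat{\mathrm{RB}}_\alpha(R_\mu)$. The map $\Phi$. For a $\mathbb C$-linear map $\beta:\mathcal B\langle\mathcal X\rangle\to\mathcal B$, $\Phi[\beta]\in\Sigma_{alg}(\mathcal B)$ is the distribution whose $B$-transform is $B_{\Phi[\beta]}^{[1]}=0$ and $B_{\Phi[\beta]}^{[n]}(b_1,\dots,b_{n-1})=\beta[b_1\mathcal Xb_2\cdots\mathcal Xb_{n-1}]$ for $n\ge2$, $b_1,\dots,b_{n-1}\in\mathcal B$ (for $n=2$ this is $\beta[b_1]$). *)

(* Defs.v *)
From HB Require Import structures.
From mathcomp Require Import all_boot all_order all_algebra.
From mathcomp Require Import generic_quotient complex.
From mathcomp Require Import boolp classical_sets reals.

Set Implicit Arguments.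
Unset Strict Implicit.
Unset Printing Implicit Defensive.

Import Order.TTheory GRing.Theory Num.Theory.
Local Open Scope ring_scope.

(* The norm is real-valued and part of the structure: the hierarchy of the
   library does not allow a join of its normed modules with its algebras.
   As for every [algType], the unit is different from 0. *)
HB.mixin Record isCStarAlgebra (R : realType) B of GRing.Algebra R[i] B := {
  cnorm : B -> R ;
  star : B -> B ;
  cnorm_triangle : forall x y : B, cnorm (x + y) <= cnorm x + cnorm y ;
  cnormZ : forall (c : R[i]) (x : B), cnorm (c *: x) = complex.Re `|c| * cnorm x ;
  cnorm_eq0 : forall x : B, cnorm x = 0 -> x = 0 ;
  cnormM_le : forall x y : B, cnorm (x * y) <= cnorm x * cnorm y ;
  cnorm_complete : forall u : nat -> B,
    (forall e : R, 0 < e -> exists N, forall m n,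
        (N <= m)%N -> (N <= n)%N -> cnorm (u m - u n) < e) ->
    exists l : B, forall e : R, 0 < e -> exists N, forall n,
        (N <= n)%N -> cnorm (u n - l) < e ;
  starK : forall x : B, star (star x) = x ;
  starD : forall x y : B, star (x + y) = star x + star y ;
  starZ : forall (c : R[i]) (x : B), star (c *: x) = Num.conj c *: star x ;
  starM : forall x y : B, star (x * y) = star y * star x ;
  cnorm_star : forall x : B, cnorm (star x * x) = cnorm x ^+ 2
}.

#[short(type="cstarAlgType")]
HB.structure Definition CStarAlgebra (R : realType) :=
  { B of GRing.Algebra R[i] B & isCStarAlgebra R B }.

(* [ncpoly B] is B<X>: the unital K-algebra generated by (a copy of) the algebra
   B and a variable X, with no further relations. Formal expressions in X and
   the elements of B are identified when the axioms of a unital K-algebra and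
   the operations of B force them to be equal; the scalar c acts as
   multiplication by [c%:A]. *)
Section NcPoly.
Variables (K : fieldType) (B : algType K).

Inductive expr :=
  | ECoef of B
  | EVar
  | EAdd of expr & expr
  | EMul of expr & expr.

Inductive expr_eq : expr -> expr -> Prop :=
  | ee_refl s : expr_eq s s
  | ee_sym s t : expr_eq s t -> expr_eq t s
  | ee_trans s t u : expr_eq s t -> expr_eq t u -> expr_eq s u
  | ee_add s s' t t' :
      expr_eq s s' -> expr_eq t t' -> expr_eq (EAdd s t) (EAdd s' t')
  | ee_mul s s' t t' :
      expr_eq s s' -> expr_eq t t' -> expr_eq (EMul s t) (EMul s' t')
  | ee_addA s t u : expr_eq (EAdd s (EAdd t u)) (EAdd (EAdd s t) u)
  | ee_addC s t : expr_eq (EAdd s t) (EAdd t s)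
  | ee_add0 s : expr_eq (EAdd (ECoef 0) s) s
  | ee_mulA s t u : expr_eq (EMul s (EMul t u)) (EMul (EMul s t) u)
  | ee_mulDl s t u : expr_eq (EMul (EAdd s t) u) (EAdd (EMul s u) (EMul t u))
  | ee_mulDr s t u : expr_eq (EMul s (EAdd t u)) (EAdd (EMul s t) (EMul s u))
  | ee_mul1l s : expr_eq (EMul (ECoef 1) s) s
  | ee_mul1r s : expr_eq (EMul s (ECoef 1)) s
  | ee_mul0l s : expr_eq (EMul (ECoef 0) s) (ECoef 0)
  | ee_coefD b b' : expr_eq (ECoef (b + b')) (EAdd (ECoef b) (ECoef b'))
  | ee_coefM b b' : expr_eq (ECoef (b * b')) (EMul (ECoef b) (ECoef b'))
  | ee_scale (c : K) s :
      expr_eq (EMul (ECoef c%:A) s) (EMul s (ECoef c%:A)).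

HB.instance Definition _ := gen_eqMixin expr.
HB.instance Definition _ := gen_choiceMixin expr.

Definition expr_eqb (s t : expr) : bool := `[< expr_eq s t >].

Lemma expr_eqb_refl : reflexive expr_eqb.
Proof. by move=> s; apply/asboolP; exact: ee_refl. Qed.

Lemma expr_eqb_sym : symmetric expr_eqb.
Proof. by move=> s t; apply/asboolP/asboolP; exact: ee_sym. Qed.

Lemma expr_eqb_trans : transitive expr_eqb.
Proof. by move=> t s u /asboolP st /asboolP tu; apply/asboolP; exact: ee_trans tu. Qed.

Canonical expr_equiv :=
  EquivRel expr_eqb expr_eqb_refl expr_eqb_sym expr_eqb_trans.

Definition ncpoly := {eq_quot expr_equiv}%qT.

HB.instance Definition _ : Choice ncpoly := Choice.on ncpoly.
HB.instance Definition _ := Quotient.on ncpoly.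

Local Notation cls := (\pi_(ncpoly)%qT : expr -> ncpoly).

Lemma clsP (s t : expr) : cls s = cls t <-> expr_eq s t.
Proof.
split=> [/eqP|st]; first by rewrite piE /= => /asboolP.
by apply/eqP; rewrite piE /=; apply/asboolP.
Qed.

Lemma clsK (p : ncpoly) : cls (repr p) = p. Proof. exact: reprK. Qed.

Definition ncC (b : B) : ncpoly := cls (ECoef b).
Definition ncX : ncpoly := cls EVar.
Definition ncpoly_add (p q : ncpoly) : ncpoly := cls (EAdd (repr p) (repr q)).
Definition ncpoly_mul (p q : ncpoly) : ncpoly := cls (EMul (repr p) (repr q)).
Definition ncpoly_scale (c : K) (p : ncpoly) : ncpoly := ncpoly_mul (ncC c%:A) p.
Definition ncpoly_opp (p : ncpoly) : ncpoly := ncpoly_scale (-1) p.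

Lemma cls_add s t : cls (EAdd s t) = ncpoly_add (cls s) (cls t).
Proof. by apply/clsP/ee_add; apply/clsP; rewrite clsK. Qed.

Lemma cls_mul s t : cls (EMul s t) = ncpoly_mul (cls s) (cls t).
Proof. by apply/clsP/ee_mul; apply/clsP; rewrite clsK. Qed.

Lemma ncpoly_ind (P : ncpoly -> Prop) : (forall s, P (cls s)) -> forall p, P p.
Proof. by move=> Pcls p; rewrite -[p]clsK. Qed.

Lemma ncpoly_addA : associative ncpoly_add.
Proof.
elim/ncpoly_ind=> s; elim/ncpoly_ind=> t; elim/ncpoly_ind=> u.
by rewrite -!cls_add; apply/clsP/ee_addA.
Qed.

Lemma ncpoly_addC : commutative ncpoly_add.
Proof.
elim/ncpoly_ind=> s; elim/ncpoly_ind=> t.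
by rewrite -!cls_add; apply/clsP/ee_addC.
Qed.

Lemma ncpoly_add0 : left_id (ncC 0) ncpoly_add.
Proof. by elim/ncpoly_ind=> s; rewrite -!cls_add; apply/clsP/ee_add0. Qed.

Lemma ncpoly_mulA : associative ncpoly_mul.
Proof.
elim/ncpoly_ind=> s; elim/ncpoly_ind=> t; elim/ncpoly_ind=> u.
by rewrite -!cls_mul; apply/clsP/ee_mulA.
Qed.

Lemma ncpoly_mulDl : left_distributive ncpoly_mul ncpoly_add.
Proof.
elim/ncpoly_ind=> s; elim/ncpoly_ind=> t; elim/ncpoly_ind=> u.
by rewrite -!(cls_mul, cls_add); apply/clsP/ee_mulDl.
Qed.

Lemma ncpoly_mulDr : right_distributive ncpoly_mul ncpoly_add.
Proof.
elim/ncpoly_ind=> s; elim/ncpoly_ind=> t; elim/ncpoly_ind=> u.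
by rewrite -!(cls_mul, cls_add); apply/clsP/ee_mulDr.
Qed.

Lemma ncpoly_mul1l : left_id (ncC 1) ncpoly_mul.
Proof. by elim/ncpoly_ind=> s; rewrite -!cls_mul; apply/clsP/ee_mul1l. Qed.

Lemma ncpoly_mul1r : right_id (ncC 1) ncpoly_mul.
Proof. by elim/ncpoly_ind=> s; rewrite -!cls_mul; apply/clsP/ee_mul1r. Qed.

Lemma ncpoly_mul0l : left_zero (ncC 0) ncpoly_mul.
Proof. by elim/ncpoly_ind=> s; rewrite -!cls_mul; apply/clsP/ee_mul0l. Qed.

Lemma ncpoly_coefD b b' : ncC (b + b') = ncpoly_add (ncC b) (ncC b').
Proof. by rewrite -cls_add; apply/clsP/ee_coefD. Qed.

Lemma ncpoly_coefM b b' : ncC (b * b') = ncpoly_mul (ncC b) (ncC b').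
Proof. by rewrite -cls_mul; apply/clsP/ee_coefM. Qed.

Lemma ncpoly_scaleC (c : K) p : ncpoly_mul (ncC c%:A) p = ncpoly_mul p (ncC c%:A).
Proof.
by elim/ncpoly_ind: p => s; rewrite -!cls_mul; apply/clsP/ee_scale.
Qed.

Lemma ncpoly_addN : left_inverse (ncC 0) ncpoly_opp ncpoly_add.
Proof.
move=> p; rewrite /ncpoly_opp /ncpoly_scale -{2}[p]ncpoly_mul1l -ncpoly_mulDl.
by rewrite -ncpoly_coefD scaleN1r addNr ncpoly_mul0l.
Qed.

HB.instance Definition _ := GRing.isZmodule.Build ncpoly
  ncpoly_addA ncpoly_addC ncpoly_add0 ncpoly_addN.

(* Evaluation at X = 0. *)
Fixpoint expr_eval0 (s : expr) : B :=
  match s with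
  | ECoef b => b
  | EVar => 0
  | EAdd s t => expr_eval0 s + expr_eval0 t
  | EMul s t => expr_eval0 s * expr_eval0 t
  end.

Lemma expr_eval0_eq s t : expr_eq s t -> expr_eval0 s = expr_eval0 t.
Proof.
elim=> //=; try by move=> *; congruence.
- by move=> *; rewrite addrA.
- by move=> *; rewrite addrC.
- by move=> *; rewrite add0r.
- by move=> *; rewrite mulrA.
- by move=> *; rewrite mulrDl.
- by move=> *; rewrite mulrDr.
- by move=> *; rewrite mul1r.
- by move=> *; rewrite mulr1.
- by move=> *; rewrite mul0r.
- by move=> c u; rewrite -scalerAl -scalerAr mul1r mulr1.
Qed.

Definition eval0 (p : ncpoly) : B := expr_eval0 (repr p).

Lemma eval0_cls s : eval0 (cls s) = expr_eval0 s.
Proof. by apply/expr_eval0_eq/clsP; rewrite clsK. Qed.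

Lemma ncpoly_1neq0 : ncC 1 != ncC 0.
Proof.
apply/eqP => /(congr1 eval0); rewrite !eval0_cls /= => /eqP.
by rewrite oner_eq0.
Qed.

HB.instance Definition _ := GRing.Zmodule_isNzRing.Build ncpoly
  ncpoly_mulA ncpoly_mul1l ncpoly_mul1r ncpoly_mulDl ncpoly_mulDr ncpoly_1neq0.

Lemma ncpoly_scaleA (a b : K) (p : ncpoly) :
  ncpoly_scale a (ncpoly_scale b p) = ncpoly_scale (a * b) p.
Proof.
by rewrite /ncpoly_scale ncpoly_mulA -ncpoly_coefM -scalerAl mul1r scalerA.
Qed.

Lemma ncpoly_scale1 : left_id 1 ncpoly_scale.
Proof. by move=> p; rewrite /ncpoly_scale scale1r ncpoly_mul1l. Qed.

Lemma ncpoly_scaleDr : right_distributive ncpoly_scale +%R.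
Proof. by move=> c p q; exact: ncpoly_mulDr. Qed.

Lemma ncpoly_scaleDl (p : ncpoly) :
  {morph ncpoly_scale^~ p : a b / a + b >-> a + b}.
Proof.
by move=> a b; rewrite /ncpoly_scale scalerDl ncpoly_coefD; exact: ncpoly_mulDl.
Qed.

HB.instance Definition _ := GRing.Zmodule_isLmodule.Build K ncpoly
  ncpoly_scaleA ncpoly_scale1 ncpoly_scaleDr ncpoly_scaleDl.

Lemma ncpoly_scaleAl (c : K) (p q : ncpoly) : c *: (p * q) = c *: p * q.
Proof. exact: ncpoly_mulA. Qed.

HB.instance Definition _ := GRing.Lmodule_isLalgebra.Build K ncpoly ncpoly_scaleAl.

Lemma ncpoly_scaleAr (c : K) (p q : ncpoly) : c *: (p * q) = p * (c *: q).
Proof.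
have E (r : ncpoly) : c *: r = r * ncC c%:A by exact: ncpoly_scaleC.
by rewrite !E mulrA.
Qed.

HB.instance Definition _ := GRing.Lalgebra_isAlgebra.Build K ncpoly ncpoly_scaleAr.

Lemma eval0_linear : linear eval0.
Proof.
move=> c; elim/ncpoly_ind=> s; elim/ncpoly_ind=> t.
have -> : c *: cls s + cls t = cls (EAdd (EMul (ECoef c%:A) s) t).
  by rewrite cls_add cls_mul.
by rewrite !eval0_cls /= -scalerAl mul1r.
Qed.

HB.instance Definition _ := GRing.isLinear.Build K ncpoly B _ eval0 eval0_linear.

(* [monomX b0 [:: b1; ...; bn]] is b0 X b1 ... X bn. *)
Fixpoint monomX (b0 : B) (bs : seq B) : ncpoly :=
  if bs is b1 :: bs' then ncC b0 * ncX * monomX b1 bs' else ncC b0.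

(* [momentX [:: b1; ...; bn]] is X b1 X ... bn X. *)
Fixpoint momentX (bs : seq B) : ncpoly :=
  if bs is b :: bs' then ncX * ncC b * momentX bs' else ncX.

End NcPoly.

Section Monomials.
Variables (K : fieldType) (B : algType K) (V : lmodType K).

Fixpoint join_words (u v : seq B) : seq B :=
  match u, v with
  | [::], _ => v
  | [:: a], b :: v' => a * b :: v'
  | a :: u', _ => a :: join_words u' v
  end.

Fixpoint expand_words (s : expr B) : seq (seq B) :=
  match s with
  | ECoef b => [:: [:: b]]
  | EVar => [:: [:: 1; 1]]
  | EAdd s t => expand_words s ++ expand_words t
  | EMul s t => [seq join_words u v | u <- expand_words s, v <- expand_words t]
  end.

Definition multilinear (F : seq B -> V) : Prop :=
  forall u v : seq B, linear (fun b : B => F (u ++ b :: v)).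

Lemma join_words0 u : join_words u [::] = u.
Proof. by elim: u => //= a [|b u] //= ->. Qed.

Lemma join_wordsA : associative join_words.
Proof.
elim=> [|a [|a' u] IH] [|b v] [|c w] //; rewrite ?join_words0 //.
  by case: v => [|b' v] //=; rewrite mulrA.
by move: (IH (b :: v) (c :: w)) => /= ->; case: u {IH} => [|x u] //=; case: v.
Qed.

Definition value (F : seq B -> V) (s : expr B) : V := \sum_(w <- expand_words s) F w.

Lemma valueD F s t : value F (EAdd s t) = value F s + value F t.
Proof. exact: big_cat. Qed.

Lemma valueM F s t :
  value F (EMul s t) = value (fun u => value (fun v => F (join_words u v)) t) s.
Proof. by rewrite /value big_allpairs_dep. Qed.

Lemma valueM' F s t :
  value F (EMul s t) = value (fun v => value (fun u => F (join_words u v)) s) t.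
Proof. by rewrite valueM /value exchange_big. Qed.

Lemma join_words_last u a b : join_words (rcons u a) [:: b] = rcons u (a * b).
Proof. by elim: u => //= e u ->; case: u. Qed.

Lemma multilinear_joinl F v : multilinear F -> multilinear (fun u => F (join_words u v)).
Proof.
move=> Flin x y c b b'.
have J (d : B) : join_words (x ++ d :: y) v = x ++ join_words (d :: y) v.
  by elim: x => [|a x IH] //=; rewrite IH; case: x {IH}.
rewrite !J; case: y {J} => [|e y] /=; last exact: Flin.
case: v => [|f v] /=; first exact: Flin.
rewrite mulrDl -scalerAl; exact: Flin.
Qed.

Lemma multilinear_joinr F u : multilinear F -> multilinear (fun v => F (join_words u v)).
Proof.
move=> Flin x y c b b'.
elim/last_ind: u => [|u a _] /=; first exact: Flin.
have J (w : seq B) (d : B) : join_words (rcons u a) (d :: w) = u ++ a * d :: w.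
  by elim: u {x y b b'} => [|e u IH] //=; rewrite IH; case: u {IH}.
case: x => [|d x] /=; last by rewrite !J -!cat_cons !catA; exact: Flin.
rewrite !J mulrDr -scalerAr; exact: Flin.
Qed.

Lemma multilinear_sum (I : Type) (r : seq I) (F : I -> seq B -> V) :
  (forall i, multilinear (F i)) -> multilinear (fun u => \sum_(i <- r) F i u).
Proof.
move=> Flin x y c b b'; rewrite scaler_sumr -big_split.
by apply: eq_bigr => i _; exact: Flin.
Qed.

Lemma multilinear0 F u v : multilinear F -> F (u ++ 0 :: v) = 0.
Proof.
move=> Flin; have /= := Flin u v (-1) 0 0.
by rewrite !scaleN1r oppr0 addr0 addNr.
Qed.

Lemma value_ext F G s : F =1 G -> value F s = value G s.
Proof. by move=> FG; apply: eq_bigr => w _. Qed.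

Lemma value_coef F b : value F (ECoef b) = F [:: b].
Proof. by rewrite /value big_seq1. Qed.

Lemma multilinearD F u v a b : multilinear F ->
  F (u ++ (a + b) :: v) = F (u ++ a :: v) + F (u ++ b :: v).
Proof. by move=> Flin; have /= := Flin u v 1 a b; rewrite !scale1r. Qed.

Lemma multilinearZ F u v (c : K) b : multilinear F ->
  F (u ++ c *: b :: v) = c *: F (u ++ b :: v).
Proof.
by move=> Flin; have /= := Flin u v c b 0; rewrite multilinear0 // !addr0.
Qed.

Lemma expand_words_neq0 s w : w \in expand_words s -> w != [::].
Proof.
elim: s w => [b||s IHs t IHt|s IHs t IHt] w /=.
- by rewrite inE => /eqP->.
- by rewrite inE => /eqP->.
- by rewrite mem_cat => /orP[/IHs|/IHt].
- case/allpairsP => -[u v] /= [/IHs + /IHt + ->].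
  by case: u => [|a [|a' u]] //; case: v.
Qed.

Lemma value_ext_in F G s : (forall w, w != [::] -> F w = G w) -> value F s = value G s.
Proof. by move=> FG; apply: eq_big_seq => w /expand_words_neq0/FG. Qed.

Lemma value_eq s t : expr_eq s t -> forall F, multilinear F -> value F s = value F t.
Proof.
have ml t' : forall F, multilinear F ->
    multilinear (fun u => value (fun v => F (join_words u v)) t').
  by move=> F Flin; apply: multilinear_sum => v; exact: multilinear_joinl.
elim=> {s t}.
- by [].
- by move=> s t _ IH F Flin; rewrite IH.
- by move=> s t u _ IH _ IH' F Flin; rewrite IH // IH'.
- by move=> s s' t t' _ IH _ IH' F Flin; rewrite !valueD IH // IH'.
- move=> s s' t t' _ IH _ IH' F Flin; rewrite !valueM IH; last exact: ml.
  by apply: value_ext => u; apply: IH'; exact: multilinear_joinr.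
- by move=> s t u F _; rewrite !valueD addrA.
- by move=> s t F _; rewrite !valueD addrC.
- move=> s F Flin; rewrite valueD value_coef.
  by rewrite (multilinear0 [::] [::]) ?add0r.
- move=> s t u F _; rewrite !valueM; apply: value_ext => x.
  rewrite valueM; apply: value_ext => y; apply: value_ext => z.
  by rewrite join_wordsA.
- by move=> s t u F _; rewrite valueD !valueM -valueD.
- by move=> s t u F _; rewrite valueD !valueM' -valueD.
- move=> s F _; rewrite valueM value_coef; apply: value_ext_in => -[|b w] _ //=.
  by rewrite mul1r.
- move=> s F _; rewrite valueM'; rewrite value_coef; apply: value_ext_in => w w0.
  by case/lastP: w w0 => // w b _; rewrite join_words_last mulr1.
- move=> s F Flin; rewrite valueM !value_coef (multilinear0 [::] [::]) // /value.
  by rewrite big_seq big1 // => -[|b w] //= /expand_words_neq0 // _; rewrite mul0r (multilinear0 [::]).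
- by move=> a b F Flin; rewrite valueD !value_coef (multilinearD [::] [::]).
- by move=> a b F _; rewrite valueM !value_coef.
- move=> c s F Flin; rewrite valueM valueM' !value_coef.
  apply: value_ext_in => w w0.
  have E1 : F (join_words [:: c%:A] w) = c *: F w.
    case: w w0 => //= b w _.
    by rewrite -scalerAl mul1r (multilinearZ [::]).
  rewrite E1; case/lastP: w w0 {E1} => // w b _.
  by rewrite join_words_last -scalerAr mulr1 -cats1 -cats1 multilinearZ.
Qed.

(* A linear map out of B<X> is the same thing as a family of multilinear maps
   B^(n+1) -> V: as a vector space, B<X> is the direct sum of the tensor powers. *)
Lemma monomX_extend (F : seq B -> V) : multilinear F ->
  exists L : {linear ncpoly B -> V}, forall b bs, L (monomX b bs) = F (b :: bs).
Proof.
move=> Flin.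
pose L (p : ncpoly B) := value F (repr p).
have Lcls s : L (\pi_(ncpoly B)%qT s) = value F s.
  by apply: value_eq => //; apply/clsP; rewrite clsK.
have Llin : linear L.
  move=> c; elim/ncpoly_ind=> s; elim/ncpoly_ind=> t.
  have -> : c *: \pi_(ncpoly B)%qT s + \pi_(ncpoly B)%qT t =
            \pi_(ncpoly B)%qT (EAdd (EMul (ECoef c%:A) s) t).
    by rewrite cls_add cls_mul.
  rewrite !Lcls valueD valueM value_coef; congr (_ + _).
  rewrite /value scaler_sumr; apply: value_ext_in => -[|b w] //= _.
  by rewrite -scalerAl mul1r (multilinearZ [::]).
pose Lm := GRing.isLinear.Build K (ncpoly B) V _ L Llin.
pose L' : {linear ncpoly B -> V} := HB.pack L Lm.
exists L' => b bs; rewrite /L' /=.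
have [s [-> E]] : exists s, monomX b bs = \pi_(ncpoly B)%qT s /\ expand_words s = [:: b :: bs].
  elim: bs b => [|b' bs IH] b /=; first by exists (ECoef b).
  have [s [-> E]] := IH b'; exists (EMul (EMul (ECoef b) (EVar B)) s).
  by rewrite !cls_mul /= E /= mulr1 mul1r.
by rewrite Lcls /value E big_seq1.
Qed.

Lemma monomX_span (L L' : {linear ncpoly B -> V}) :
  (forall b bs, L (monomX b bs) = L' (monomX b bs)) -> L =1 L'.
Proof.
move=> LL'; have mulm b bs c cs : exists d ds,
    monomX b bs * monomX c cs = monomX d ds :> ncpoly B.
  elim: bs b => [|b' bs IH] b /=.
    case: cs => [|c' cs] /=; first by exists (b * c), [::]; rewrite /= ncpoly_coefM.
    by exists (b * c), (c' :: cs); rewrite /= ncpoly_coefM !mulrA.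
  by have [d [ds E]] := IH b'; exists b, (d :: ds); rewrite -mulrA E.
have span (p : ncpoly B) : exists ms : seq (B * seq B),
    p = \sum_(m <- ms) monomX m.1 m.2.
  elim/ncpoly_ind: p; elim=> [b||s [ms Es] t [ns Et]|s [ms Es] t [ns Et]].
  - by exists [:: (b, [::])]; rewrite big_seq1.
  - by exists [:: (1, [:: 1])]; rewrite big_seq1 /= [RHS]mulr1 [RHS]mul1r.
  - by exists (ms ++ ns); rewrite big_cat /= -Es -Et; exact: cls_add.
  - rewrite cls_mul Es Et {Es Et}.
    have -> (p q : ncpoly B) : ncpoly_mul p q = p * q by [].
    rewrite big_distrl /=.
    elim: ms => [|m ms [rs Er]]; first by exists [::]; rewrite !big_nil.
    rewrite big_cons Er big_distrr /= {Er}.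
    elim: ns => [|k ns [qs Eq]]; first by exists rs; rewrite big_nil add0r.
    have [d [ds E]] := mulm m.1 m.2 k.1 k.2.
    by exists ((d, ds) :: qs); rewrite !big_cons -addrA Eq E.
by move=> p; have [ms ->] := span p; rewrite !linear_sum; apply: eq_bigr.
Qed.

End Monomials.

Section Distributions.
Variables (K : fieldType) (B : algType K).

Record algdist := Algdist {
  algdist_fun :> {linear ncpoly B -> B};
  algdist_bimod : forall (b : B) (p : ncpoly B) (b' : B),
    algdist_fun (ncC b * p * ncC b') = b * algdist_fun p * b';
  algdist_coef : forall b : B, algdist_fun (ncC b) = b
}.

HB.instance Definition _ := gen_eqMixin algdist.
HB.instance Definition _ := gen_choiceMixin algdist.

Lemma eval0_bimod (b : B) (p : ncpoly B) (b' : B) :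
  eval0 (ncC b * p * ncC b') = b * eval0 p * b'.
Proof.
elim/ncpoly_ind: p => s.
have -> : ncC b * \pi_(ncpoly B)%qT s * ncC b' =
          \pi_(ncpoly B)%qT (EMul (EMul (ECoef b) s) (ECoef b')).
  by rewrite !cls_mul.
by rewrite !eval0_cls.
Qed.

Lemma eval0_coef (b : B) : eval0 (ncC b) = b.
Proof. by rewrite eval0_cls. Qed.

Definition algdist0 : algdist := Algdist eval0_bimod eval0_coef.

(* A series F is encoded by one function on finite sequences: F^[n], a function
   of n - 1 arguments, is its restriction to the sequences of size n - 1. Thus
   [F [::]] is F^[1]. *)
Definition bseries := seq B -> B.

Definition Ser : set bseries := [set F | multilinear F].

Definition moments (mu : algdist) : bseries := fun bs => mu (momentX bs).

(* Reading a string of symbols as a parenthesized expression. *)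
Inductive symbol :=
  | SOpen of bseries
  | SClose
  | SComma
  | SSingle of bseries
  | SCoef of B.

(* The state is the product read so far at the current nesting level, together
   with the stack of the calls that are still open: their functional, their
   complete arguments, and the product that stands to the left of the call. *)
Definition state := (B * seq (bseries * seq B * B))%type.

Definition read_symbol (st : state) (w : symbol) : state :=
  let: (cur, stack) := st in
  match w, stack with
  | SOpen f, _ => (1, (f, [::], cur) :: stack)
  | SClose, (f, args, before) :: stack' => (before * f (rcons args cur), stack')
  | SComma, (f, args, before) :: stack' => (1, (f, rcons args cur, before) :: stack')
  | SSingle f, _ => (cur * f [::], stack)
  | SCoef b, _ => (cur * b, stack)
  | _, [::] => st
  end.

Definition read_string (ws : seq symbol) : B := (foldl read_symbol (1, [::]) ws).1.

Fixpoint interleave (ws : seq symbol) (bs : seq B) : seq symbol :=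
  if (ws, bs) is (w :: ws', b :: bs') then w :: SCoef b :: interleave ws' bs'
  else ws.

(* The symbol W_i for the partition P, when the block V uses the series [S V]. *)
Definition block_symbol n (S : {set 'I_n} -> bseries) (P : {set {set 'I_n}})
    (i : 'I_n) : symbol :=
  let V := finset.pblock P i in
  if V == [set i] then SSingle (S V)
  else if [forall j in V, (i <= j)%N] then SOpen (S V)
  else if [forall j in V, (j <= i)%N] then SClose
  else SComma.

Definition nested_by n (S : {set 'I_n} -> bseries) (P : {set {set 'I_n}}) : bseries :=
  fun bs => read_string (interleave [seq block_symbol S P i | i <- enum 'I_n] bs).

Definition nested (F : bseries) n (P : {set {set 'I_n}}) : bseries :=
  nested_by (fun _ => F) P.

(* The colour 1 is [true] and the colour 2 is [false]. *)
Definition nested_col (F G : bseries) n (P : {set {set 'I_n}})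
    (c : {set 'I_n} -> bool) : bseries :=
  nested_by (fun V => if c V then F else G) P.

End Distributions.

Definition noncrossing n (P : {set {set 'I_n}}) : bool :=
  [forall V in P, forall W in P, forall a in V, forall b in W, forall c in V,
   forall d in W, [&& (a < b)%N, (b < c)%N & (c < d)%N] ==> (V == W)].

Definition NC n : {set {set {set 'I_n}}} :=
  [set P | finset.partition P [set: 'I_n] & noncrossing P].

Definition IntNC n : {set {set {set 'I_n}}} :=
  [set P in NC n | [forall V in P, forall i in V, forall k in V, forall j : 'I_n,
                     (i <= j <= k)%N ==> (j \in V)]].

Section Transforms.
Variables (K : fieldType) (B : algType K).
Implicit Types (mu nu : algdist B) (F : bseries B).

Definition is_Rtransform mu F : Prop := Ser F /\
  forall bs : seq B, moments mu bs = \sum_(P in NC (size bs).+1) nested F P bs.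

Definition is_Btransform mu F : Prop := Ser F /\
  forall bs : seq B, moments mu bs = \sum_(P in IntNC (size bs).+1) nested F P bs.

(* In this section [xget x0 D] is the unique element of D; the default value x0
   is immaterial. *)
Definition Rtransform mu : bseries B := xget (fun _ => 0) [set F | is_Rtransform mu F].

Definition Btransform mu : bseries B := xget (fun _ => 0) [set F | is_Btransform mu F].

Definition algdist_of_R F : algdist B :=
  xget (algdist0 B) [set mu | Rtransform mu = F].

Definition algdist_of_B F : algdist B :=
  xget (algdist0 B) [set mu | Btransform mu = F].

Definition boxplus mu nu : algdist B :=
  algdist_of_R (Rtransform mu \+ Rtransform nu).

Definition semicircular_series (alpha : {linear B -> B}) : bseries B :=
  fun bs => if bs is [:: b] then alpha b else 0.

Definition semicircular (alpha : {linear B -> B}) : algdist B :=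
  algdist_of_R (semicircular_series alpha).

(* [n.+1] is the size of the ground set, whose minimum and maximum are [ord0]
   and [ord_max]. *)
Definition outer_block n (P : {set {set 'I_n.+1}}) : {set 'I_n.+1} := finset.pblock P ord0.

Definition RBhat (alpha : {linear B -> B}) F : bseries B := fun bs =>
  \sum_(P in NC (size bs).+1 | ord_max \in outer_block P)
     nested_col F (alpha \o F) P (fun V => V == outer_block P) bs.

Definition BB (alpha : {linear B -> B}) mu : algdist B :=
  algdist_of_R (RBhat alpha (Rtransform mu)).

Definition Phi_series (beta : {linear ncpoly B -> B}) : bseries B :=
  fun bs => if bs is b :: bs' then beta (monomX b bs') else 0.

Definition Phi (beta : {linear ncpoly B -> B}) : algdist B :=
  algdist_of_B (Phi_series beta).

End Transforms.

(* Main.v *)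
Require Import Defs.
From HB Require Import structures.
From mathcomp Require Import all_boot all_order all_algebra.
From mathcomp Require Import complex reals boolp.

(** The proof replaces sums over non-crossing partitions by equations between
    series. A series is a function of the word of its arguments; [prods] is the
    product over all ways to cut a word in two, and [comps f g] substitutes [g]
    in [f], that is, sums f(g(p1), ..., g(pk)) over all decompositions of a word
    into nonempty pieces. Let I be the identity on words of one letter, and let
    [Phi_series mu] be the series of the values of mu at b0 X b1 ... X bn. It is
    determined by the moments, because mu is a bimodule map.

    Conditioning on the block of the first point shows that m = [Phi_series mu]
    solves m = I + I b m ([mom_op]), where b is the B-transform of mu, and that
    b = F o m, where F is its R-transform ([Rtransform_mom], [Btransform_mom]).
    In the same way, RBhat(F) = F o rho, where rho = I + I (alpha F o rho) rho is
    the series of the distribution with R-transform alpha o F ([RBhat_comps]).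
    All these equations determine their solutions by recursion on the length of
    words ([contractive]); this also yields the existence and the uniqueness of
    the transforms.

    The B-transform of Phi(beta) is [Phi_series beta], so two B-transforms must
    be compared. For x = [Phi_series] of beta boxplus gamma_alpha, whose
    R-transform is that of beta plus the semicircular one, [comps_subordination]
    gives x = [Phi_series beta] o k with k = I + I (alpha x) k. For the
    B-transform T of the right-hand side, [comps_Boolean] gives
    T = [Phi_series beta] o k with k = I + I (alpha T) k. In both cases k solves
    the same equation k = I + I ((alpha o [Phi_series beta]) o k) k, so x = T.
    Both steps rest on the right distributivity of the substitution over sums and
    products, its associativity, and a resolvent identity.

    The passage from partitions to series goes through words. A non-crossing
    partition is coded by recording for each point whether its block has earlier
    and later points; the codes are the words whose depth, the number of open
    blocks, stays nonnegative and ends at 0 ([big_NC]). Reading a string of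
    symbols is then a process with a stack, and the sum of the readings of all
    words from a given state has a closed form, [stack_value], that is verified
    letter by letter ([words_valueE]). *)

Set Implicit Arguments.
Unset Strict Implicit.
Unset Printing Implicit Defensive.

(** * Non-crossing sequences of labels *)

(** A point of a partition is coded by two bits: does its block have an earlier
    point, and does it have a later point. So [(false, true)] opens a block,
    [(true, false)] closes it, [(true, true)] stands for a comma and
    [(false, false)] for a singleton. *)
Notation letter := (bool * bool)%type.

Section Words.
Variables o i : bool.

(** The depth is the number of open blocks. The flag [o] permits blocks that
    start at depth 0, and [i] those that start inside another block: both flags
    give all non-crossing partitions, [o] alone gives the interval partitions,
    and [i] alone the continuations of a block that lasts until the end. *)
Definition allowed (d : nat) (a : letter) : bool :=
  if a.1 then 0 < d else if d == 0 then o else i.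

Definition depth_after (d : nat) (a : letter) : nat :=
  match a with
  | (false, true) => d.+1
  | (true, false) => d.-1
  | _ => d
  end.

Fixpoint valid (d : nat) (w : seq letter) : bool :=
  if w is a :: w' then allowed d a && valid (depth_after d a) w' else d == 0.

Definition letters : seq letter :=
  [:: (false, false); (false, true); (true, true); (true, false)].

Fixpoint words (d n : nat) : seq (seq letter) :=
  if n is n'.+1 then
    [seq a :: w | a <- [seq a <- letters | allowed d a], w <- words (depth_after d a) n']
  else if d == 0 then [:: [::]] else [::].

Lemma wordsS d n : words d n.+1 =
  [seq a :: w | a <- [seq a <- letters | allowed d a], w <- words (depth_after d a) n].
Proof. by []. Qed.

Lemma mem_allowed d a : (a \in [seq a <- letters | allowed d a]) = allowed d a.
Proof. by rewrite (mem_filter (allowed d) a letters); case: a => -[] []; rewrite andbT. Qed.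

Lemma mem_words d n w : (w \in words d n) = (size w == n) && valid d w.
Proof.
elim: n d w => [|n IHn] d w; first by case: w => [|a w] /=; case: (d == 0).
rewrite wordsS; apply/allpairsPdep/andP => [[b [v [okb + ->]]]|].
  rewrite IHn => /andP[/eqP sv va]; rewrite /= sv eqxx va andbT.
  by move: okb; rewrite mem_allowed.
case: w => [[]//|a w] /=; rewrite eqSS => -[sw /andP[ok va]].
by exists a, w; split; rewrite ?mem_allowed ?IHn ?sw.
Qed.

Lemma words_uniq d n : uniq (words d n).
Proof.
elim: n d => [|n IHn] d; first by rewrite /=; case: (d == 0).
rewrite wordsS; apply: allpairs_uniq_dep => [|a _|]; first exact: filter_uniq.
  exact: IHn.
by move=> [a v] [b w] _ _ /= [-> ->].
Qed.

End Words.

(** A letter acts on the stack of the labels of the open blocks as it acts on the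
    depth; only the top of the stack can be continued or closed, which is
    exactly the absence of crossings. *)
Definition push_label (T : Type) (x : T) (st : seq T) (a : letter) : seq T :=
  match a with
  | (false, true) => x :: st
  | (true, false) => behead st
  | _ => st
  end.

Lemma size_push_label (T : Type) (x : T) st a :
  allowed true true (size st) a -> size (push_label x st a) = depth_after (size st) a.
Proof. by case: a st => -[] [] //= st _; rewrite size_behead. Qed.

Section Profile.
Variable T : eqType.
Implicit Types (x : T) (s t u v pre st : seq T).

Fixpoint profile pre s : seq letter :=
  if s is x :: s' then (x \in pre, x \in s') :: profile (x :: pre) s' else [::].

Lemma size_profile pre s : size (profile pre s) = size s.
Proof. by elim: s pre => //= x s IHs pre; rewrite IHs. Qed.

Definition noncrossing_seq s := forall a b : T, subseq [:: a; b; a; b] s -> a = b.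
Definition interval_seq s := forall a b : T, subseq [:: a; b; a] s -> a = b.

Lemma noncrossing_subseq s t : subseq s t -> noncrossing_seq t -> noncrossing_seq s.
Proof. by move=> st nct a b sub; apply: nct; exact: subseq_trans st. Qed.

Lemma interval_subseq s t : subseq s t -> interval_seq t -> interval_seq s.
Proof. by move=> st nct a b sub; apply: nct; exact: subseq_trans st. Qed.

(** A pattern without equal neighbours uses at most one of two equal adjacent
    entries, so that forbidding such a pattern allows an entry to be doubled. *)
Lemma subseq_undouble t u x v : sorted (fun a b => a != b) t ->
  subseq t (u ++ x :: x :: v) -> subseq t (u ++ x :: v).
Proof.
elim: u t => [|y u IHu] [|a t] pt; rewrite ?sub0seq //.
  rewrite /=; have [eax|/negbTE ax] := boolP (a == x); last by rewrite ax.
  case: t pt => [|b t] /=; first by rewrite sub0seq.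
  by rewrite (eqP eax) => /andP[/negbTE]; rewrite eq_sym => ->.
move=> /=; case: eqP => _; apply: IHu => //.
by case: t pt => //= b t /andP[].
Qed.

Lemma noncrossing_double u x v :
  noncrossing_seq (u ++ x :: v) -> noncrossing_seq (u ++ x :: x :: v).
Proof.
move=> nc a b; have [//|ab] := eqVneq a b.
by move/subseq_undouble => /= /(_ _)/nc -> //; rewrite ab eq_sym ab.
Qed.

Lemma interval_double u x v :
  interval_seq (u ++ x :: v) -> interval_seq (u ++ x :: x :: v).
Proof.
move=> nc a b; have [//|ab] := eqVneq a b.
by move/subseq_undouble => /= /(_ _)/nc -> //; rewrite ab eq_sym ab.
Qed.

(** The forbidden pattern uses each of its labels twice, and a new label only
    occurs once. *)
Lemma noncrossing_insert u x v :
  x \notin u ++ v -> noncrossing_seq (u ++ v) -> noncrossing_seq (u ++ x :: v).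
Proof.
move=> xuv nc a b sub.
have cx : count_mem x (u ++ x :: v) = 1.
  have /count_memPn := xuv; rewrite !count_cat /= eqxx => /eqP.
  by rewrite addn_eq0 => /andP[/eqP-> /eqP->].
have xn : all (predC1 x) [:: a; b; a; b].
  apply/allP => y yab; apply/eqP => yx.
  have := leq_count_subseq (pred1 x) sub; rewrite cx leqNgt => /negP; apply.
  by move: yab; rewrite yx !inE /= => /or4P[] /eqP->; rewrite eqxx /= ?addn0 ?addn1 //; case: eqP.
have := sub; rewrite -(all_filterP xn) => sub'; apply: nc.
apply: subseq_trans (_ : subseq (filter (predC1 x) (u ++ x :: v)) _).
  by rewrite subseq_filter xn.
by rewrite !filter_cat /= eqxx /= cat_subseq // filter_subseq.
Qed.

Lemma interval_cons x v : x \notin v -> interval_seq v -> interval_seq (x :: v).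
Proof.
move=> xv iv a b /=; case: eqP => [->|_]; last exact: iv.
by move=> /mem_subseq/(_ x); rewrite !inE eqxx orbT (negPf xv) => /(_ isT).
Qed.

End Profile.

(** The decoding of a word: each point receives as label the position at which
    its block was opened. *)
Fixpoint labels (k : nat) (st : seq nat) (w : seq letter) : seq nat :=
  if w is a :: w' then
    (if a.1 then head 0 st else k) :: labels k.+1 (push_label k st a) w'
  else [::].

Lemma size_labels k st w : size (labels k st w) = size w.
Proof. by elim: w k st => //= a w IHw k st; rewrite IHw. Qed.

Definition open_labels (k : nat) (st : seq nat) : bool :=
  uniq st && all (fun h => h < k) st.

Lemma open_push_label k st a : open_labels k st -> open_labels k.+1 (push_label k st a).
Proof.
case/andP=> ust /allP stk; apply/andP; case: a => -[] [] /=.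
- by split=> //; apply/allP => h /stk/ltnW.
- by split; [case: st ust {stk} => //= h st /andP[] | apply/allP => h /mem_behead/stk/ltnW].
- split; last by rewrite ltnSn; apply/allP => h /stk/ltnW.
  by rewrite ust andbT; apply/negP => /stk; rewrite ltnn.
- by split=> //; apply/allP => h /stk/ltnW.
Qed.

Lemma labels_bound k st w l : valid true true (size st) w -> open_labels k st ->
  l \in labels k st w -> (l \in st) || (k <= l).
Proof.
elim: w k st => //= a w IHw k st /andP[ok va] op; rewrite inE => /orP[/eqP->|].
  case: a ok {va} => -[] b ok /=; last by rewrite leqnn orbT.
  by case: st {op} ok => //= h st; rewrite inE eqxx.
rewrite -(size_push_label k ok) in va.
move/(IHw _ _ va (open_push_label a op)) => /orP[|/ltnW->]; last by rewrite orbT.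
case: a {ok va} => -[] [] /=; rewrite ?inE; try by move=> ->.
  by move=> /mem_behead->.
by case/orP => [/eqP->|->] //; rewrite leqnn orbT.
Qed.

(** The depth of a valid word returns to 0, so every open block gets closed. *)
Lemma open_labels_used k st w : valid true true (size st) w ->
  {subset st <= labels k st w}.
Proof.
elim: w k st => [|a w IHw] k st /=; first by case: st.
case/andP=> ok va l lst; rewrite -(size_push_label k ok) in va.
have := IHw k.+1 _ va l; rewrite inE => IH.
case: a ok va IH => -[] [] /= ok va IH.
- by rewrite IH ?orbT.
- by case: st lst {ok va} IH => //= h st; rewrite inE => /orP[->//|lst ->]; rewrite ?orbT.
- by rewrite IH ?orbT // inE lst orbT.
- by rewrite IH ?orbT.
Qed.

(** By induction from the right: a comma doubles the label on top of the stack,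
    an opening moves its label from the word to the stack, a singleton inserts a
    fresh label, and a closing inserts a label and doubles it. *)
Lemma labels_noncrossing k st w : valid true true (size st) w -> open_labels k st ->
  noncrossing_seq (rev st ++ labels k st w).
Proof.
elim: w k st => [|a w IHw] k st /=.
  by case: st => // _ _ x y; rewrite cats0.
case/andP=> ok va op; rewrite -(size_push_label k ok) in va.
have op' := open_push_label a op.
have IH := IHw _ _ va op'; have bd l := labels_bound va op' (l := l).
have ust : forall h, h \in st -> h < k by case/andP: op => _ /allP.
case: a ok va op' IH bd => -[] [] /= ok va op' IH bd.
- case: st ok {va bd ust op op'} IH => //= h st _; rewrite rev_cons !cat_rcons => IH.
  exact: noncrossing_double.
- case: st ok {va op'} op ust bd IH => //= h st _ /andP[/= /andP[hst _] _] ust bd IH.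
  rewrite rev_cons cat_rcons; apply/noncrossing_double/noncrossing_insert => //.
  rewrite mem_cat mem_rev (negPf hst); apply/negP => /bd.
  by rewrite (negPf hst) leqNgt ltnS ltnW // ust // mem_head.
- by rewrite rev_cons cat_rcons in IH.
- apply: noncrossing_insert => //; rewrite mem_cat mem_rev.
  have kst : k \in st = false by apply/negP => /ust; rewrite ltnn.
  by rewrite kst; apply/negP => /bd; rewrite kst ltnn.
Qed.

(** Decoding and then coding gives back the word: the labels that occur later are
    those of the stack and those not yet created. *)
Lemma profile_labels k st w pre : valid true true (size st) w -> open_labels k st ->
  {subset st <= pre} -> {in pre, forall h, h < k} ->
  profile pre (labels k st w) = w.
Proof.
elim: w k st pre => //= a w IHw k st pre /andP[ok va] op stpre prek.
rewrite -(size_push_label k ok) in va; have op' := open_push_label a op.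
rewrite IHw //; first last.
- move=> h; rewrite inE => /orP[/eqP->|/prek/ltnW //].
  case: a ok {va op'} => -[] [] //=; case: st op stpre => //= h' st op stpre _;
    by rewrite ltnS ltnW // prek // stpre // mem_head.
- move=> h; case: a ok {va op'} => -[] [] //= _; rewrite !inE.
  + by move/stpre->; rewrite orbT.
  + by move/mem_behead/stpre->; rewrite orbT.
  + by case/orP => [->//|/stpre->]; rewrite orbT.
  + by move/stpre->; rewrite orbT.
congr (_ :: _).
have kpre : k \in pre = false by apply/negP => /prek; rewrite ltnn.
have kst : k \in st = false by apply/negP => /stpre; rewrite kpre.
have bd l := labels_bound va op' (l := l); have us := open_labels_used k.+1 va.
case: a ok va op' bd us => -[] [] /= ok va op' bd us.
- by case: st ok stpre us {va op op' bd kst} => //= h st _ stpre us;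
    rewrite stpre ?us ?mem_head.
- case: st ok op stpre bd prek {va op' us kst} => //= h st _.
  case/andP => /= /andP[hst _] _ stpre bd prek; rewrite stpre ?mem_head //; congr (_, _).
  apply/negP => /bd; rewrite (negPf hst) leqNgt ltnS ltnW //.
  by apply: prek; apply: stpre; rewrite mem_head.
- by rewrite kpre us // mem_head.
- by rewrite kpre; congr (_, _); apply/negP => /bd; rewrite kst ltnn.
Qed.

Section ProfileValid.
Variable T : eqType.
Implicit Types (x : T) (s pre st : seq T).

(** In a non-crossing sequence cut into [pre] and [s], the labels that occur on
    both sides form a stack [st], the most recently opened label first. The last
    clause keeps what is needed of the absence of crossings once the closed
    blocks are forgotten. *)
Record open_stack st pre s : Prop := OpenStack {
  stack_uniq : uniq st;
  stack_used : {subset st <= s};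
  stack_seen : {subset st <= pre};
  stack_full : forall x, x \in pre -> x \in s -> x \in st;
  stack_noncrossing : noncrossing_seq (rev st ++ s)
}.

Definition next_letter pre x s : letter := (x \in pre, x \in s).

(** If a label below the top were continued, its block would cross the block of
    the top, which also has to be continued later. *)
Lemma open_stack_head st pre x s : open_stack st pre (x :: s) -> x \in pre ->
  exists st', st = x :: st'.
Proof.
case=> ust used seen full nc xpre; have := full x xpre (mem_head x s).
case: st ust used seen nc {full} => // h st /= /andP[hst _] used seen nc.
rewrite inE => /orP[/eqP->|xst]; first by exists st.
have hx : h != x by apply: contraNneq hst => ->.
have hs : h \in s by have := used h (mem_head h st); rewrite inE (negPf hx).
have /nc xh : subseq [:: x; h; x; h] (rev (h :: st) ++ x :: s).
  rewrite rev_cons cat_rcons; apply: (@cat_subseq _ [:: x] [:: h; x; h]).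
    by rewrite sub1seq mem_rev.
  by rewrite /= eqxx eqxx sub1seq.
by rewrite xh eqxx in hx.
Qed.

Lemma open_stack_allowed st pre x s : open_stack st pre (x :: s) ->
  allowed true true (size st) (next_letter pre x s).
Proof.
rewrite /allowed /=; case: ifP => [xpre op|]; last by rewrite if_same.
by have [st' ->] := open_stack_head op xpre.
Qed.

Lemma open_stack_next st pre x s : open_stack st pre (x :: s) ->
  open_stack (push_label x st (next_letter pre x s)) (x :: pre) s.
Proof.
move=> op; rewrite /next_letter; have hd := open_stack_head op.
case: op => ust used seen full nc.
have ncs st' : subseq (rev st' ++ s) (rev st ++ x :: s) -> noncrossing_seq (rev st' ++ s).
  by move=> /noncrossing_subseq; apply.
have [/hd[st' est]|xpre] := boolP (x \in pre); last first.
  have xst : x \notin st by apply: contra xpre => /seen.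
  have [xs|xs] /= := boolP (x \in s).
    split=> /=.
    - by rewrite xst.
    - move=> y; rewrite inE => /orP[/eqP->//|/[dup] yst /used].
      by rewrite inE; case: eqP => [->|].
    - by move=> y; rewrite !inE => /orP[->//|/seen->]; rewrite orbT.
    - by move=> y; rewrite !inE; case: eqP => //= yx ypre ys; apply: full; rewrite ?inE ?ys ?orbT.
    - by rewrite rev_cons cat_rcons.
  split=> //.
  - move=> y yst; have := used y yst; rewrite inE; case: eqP => // yx _.
    by rewrite yx (negPf xst) in yst.
  - by move=> y /seen ypre; rewrite inE ypre orbT.
  - move=> y; rewrite inE => /orP[/eqP->|ypre ys]; first by rewrite (negPf xs).
    by apply: full; rewrite ?inE ?ys ?orbT.
  - by apply: ncs; rewrite cat_subseq // subseq_cons.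
have xpre : x \in pre by apply: seen; rewrite est mem_head.
have [xs|xs] /= := boolP (x \in s).
  split=> //.
  - by move=> y /used; rewrite inE; case: eqP => [->|].
  - by move=> y /seen ypre; rewrite inE ypre orbT.
  - move=> y; rewrite inE => yp ys; apply: full; last by rewrite inE ys orbT.
    by case/orP: yp => [/eqP->|].
  - by apply: ncs; rewrite cat_subseq // subseq_cons.
subst st; move: ust => /= /andP[xst ust]; split=> //=.
- move=> y yst; have := used y; rewrite !inE yst orbT => /(_ isT).
  by case: eqP => // yx; rewrite yx (negPf xst) in yst.
- by move=> y yst; rewrite inE seen ?orbT // inE yst orbT.
- move=> y; rewrite inE; case: eqP => [->|/eqP yx] /=; first by rewrite (negPf xs).
  move=> ypre ys; have := full y ypre; rewrite !inE ys orbT (negPf yx).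
  exact.
- apply: ncs; rewrite rev_cons cat_rcons cat_subseq //.
  exact: (@suffix_subseq _ [:: x; x]).
Qed.

Lemma profile_valid st pre s : open_stack st pre s ->
  valid true true (size st) (profile pre s).
Proof.
elim: s st pre => [|x s IHs] st pre op /=.
  by case: st op => //= h st [_ /(_ h (mem_head _ _))].
have ok := open_stack_allowed op; apply/andP; split; first exact: ok.
by have := IHs _ _ (open_stack_next op); rewrite (size_push_label x ok).
Qed.

(** Coding a non-crossing sequence and then decoding it gives back the sequence,
    with every label replaced by the position of its first occurrence. *)
Lemma labels_profile st pre s : open_stack st pre s ->
  let f := index^~ (rev pre ++ s) in
  labels (size pre) (map f st) (profile pre s) = map f s.
Proof.
elim: s st pre => //= x s IHs st pre op; have := open_stack_next op.
rewrite -/(next_letter pre x s) => /IHs /=; rewrite rev_cons cat_rcons.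
set f := index^~ _ => E; rewrite -[in RHS]E; congr (_ :: labels _ _ _).
  case: ifP => [xpre|xpre]; first by have [st' ->] := open_stack_head op xpre.
  by rewrite /f index_cat mem_rev xpre /= eqxx addn0 size_rev.
have fx : x \notin pre -> f x = size pre.
  by move=> xpre; rewrite /f index_cat mem_rev (negPf xpre) /= eqxx addn0 size_rev.
have [xpre|/fx fx'] := boolP (x \in pre); case: (x \in s) => //=; first by rewrite behead_map.
by rewrite fx'.
Qed.

(** A block that starts while another one is open lies between two points of the
    latter; so intervals amount to a depth that never exceeds 1. *)
Lemma profile_interval st pre s : open_stack st pre s -> size st <= 1 ->
  valid true false (size st) (profile pre s) <-> interval_seq (rev st ++ s).
Proof.
elim: s st pre => [|x s IHs] st pre op st1 /=.
  case: st op {st1} => [|h st [_ /(_ h (mem_head _ _))//]] _; split=> // _ a b.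
have ok := open_stack_allowed op; have := size_push_label x ok.
have := IHs _ _ (open_stack_next op); have hd := open_stack_head op.
case: op => ust used seen full nc.
move: ok; rewrite /allowed /next_letter /=.
have [/hd[st' est] ok|xpre ok] := boolP (x \in pre).
  subst st; case: st' {ust used seen full nc hd ok} st1 => // _.
  have [xs|xs] /= := boolP (x \in s).
    move=> /(_ isT)[IH IH'] _; split=> [/IH|iv]; first exact: (@interval_double _ [::]).
    by apply: IH'; apply: interval_subseq iv; exact: subseq_cons.
  move=> /(_ isT)[IH IH'] _; split=> [/IH|iv].
    by move=> iv; apply: (@interval_double _ [::]); exact: interval_cons.
  by apply: IH'; apply: interval_subseq iv; exact: (@suffix_subseq _ [:: x; x]).
case: st used seen {ust full nc hd} st1 ok => [|h [|//]] used seen s1 ok.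
  have [xs|xs] /= := boolP (x \in s); first by move=> /(_ isT).
  move=> /(_ isT)[IH IH'] _; split=> [/IH|iv]; first exact: interval_cons.
  by apply: IH'; apply: interval_subseq iv; exact: subseq_cons.
move=> _ _ /=; split=> // /(_ h x) /=; rewrite eqxx.
have hx : h != x by apply: contraNneq xpre => <-; apply: seen; rewrite mem_head.
have hs : h \in s by have := used h (mem_head h _); rewrite inE (negPf hx).
by rewrite eqxx sub1seq hs => /(_ isT) hx'; rewrite hx' eqxx in hx.
Qed.

(** Without openings at depth 0, reading must stop as soon as the bottom of the
    stack is removed; so the block at the bottom has to contain the last point. *)
Lemma profile_last st h pre s : open_stack (rcons st h) pre s ->
  valid false true (size st).+1 (profile pre s) = (last h s == h) && (s != [::]).
Proof.
elim: s st pre => [|x s IHs] st pre op /=; first by rewrite andbF.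
have := IHs _ _; have hd := open_stack_head op; have := open_stack_next op.
case: op => ust used seen full nc.
have hs : x != h -> h \in s.
  by move=> xh; have := used h; rewrite mem_rcons mem_head inE eq_sym (negPf xh); exact.
have lastx : s != [::] -> last x s = last h s by case: (s).
rewrite andbT /next_letter /allowed /=; have [/hd|xpre] := boolP (x \in pre); last first.
  have xh : x != h by apply: contraNneq xpre => ->; apply: seen; rewrite mem_rcons mem_head.
  have s0 : s != [::] by case: (s) (hs xh).
  rewrite lastx //; have [xs|xs] /= := boolP (x \in s) => op.
    by move=> /(_ (x :: st) (x :: pre) op) ->; rewrite s0 andbT.
  by move=> /(_ st (x :: pre) op) ->; rewrite s0 andbT.
move=> [st' est] op IH; case: st est op ust {full nc used seen hd} IH => [|y st] /= [-> _].
  have [xs|xs] := boolP (x \in s) => /= op _ IH.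
    have s0 : s != [::] by case: (s) xs.
    by rewrite (IH [::] (x :: pre)) // s0 andbT.
  case: (s) xs => [|y s1] xs; first by rewrite /= !eqxx.
  rewrite /= /allowed /=; case: (y \in _) => /=; apply/esym/negbTE;
    by apply: contraNneq xs => <-; exact: mem_last.
have [xs|xs] := boolP (x \in s) => /= op /andP[yst _] IH.
  have s0 : s != [::] by case: (s) xs.
  by rewrite (IH (x :: st) (x :: pre)) // s0 andbT lastx.
have s0 : s != [::].
  suff : h \in s by case: (s).
  by apply: hs; apply: contraNneq yst => ->; rewrite mem_rcons mem_head.
by rewrite (IH st (x :: pre)) // s0 andbT lastx.
Qed.

End ProfileValid.

(** * Non-crossing partitions and words *)

Section Partitions.
Variable n : nat.
Implicit Types (P : {set {set 'I_n}}) (i j : 'I_n).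

(** A partition is handled through any function that is constant exactly on its
    blocks: the block map itself, or the labels decoded from a word. *)
Definition labelled_by (T : eqType) (f : 'I_n -> T) P :=
  forall i j, (j \in pblock P i) = (f i == f j).

Lemma labelled_pblock P : partition P [set: 'I_n] -> labelled_by (pblock P) P.
Proof.
by case/and3P => /eqP cP tP _ i j; rewrite eq_pblock // cP inE.
Qed.

Lemma labelled_preim (T : eqType) (f : 'I_n -> T) :
  labelled_by f (preim_partition f [set: 'I_n]).
Proof.
move=> i j; rewrite pblock_equivalence_partition ?inE // => x y z _ _ _.
by split=> // /eqP->.
Qed.

Lemma labelled_inj (T : eqType) (f g : 'I_n -> T) P Q :
  partition P [set: 'I_n] -> partition Q [set: 'I_n] -> labelled_by f P ->
  labelled_by g Q -> (forall i j, (f i == f j) = (g i == g j)) -> P = Q.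
Proof.
move=> pP pQ fP gQ fg.
rewrite -(preim_partition_pblock pP) -(preim_partition_pblock pQ).
apply/eq_imset => i; apply/setP => j.
by rewrite !inE /= -(labelled_pblock pP) -(labelled_pblock pQ) fP gQ fg.
Qed.

(** This translates patterns in the sequence of labels into increasing tuples of
    points. *)
Lemma sub_enum_ord (t : seq 'I_n) :
  subseq t (enum 'I_n) = sorted ltn (map val t).
Proof.
apply/idP/idP => [sub|st].
  apply: (subseq_sorted ltn_trans (map_subseq val sub)).
  by rewrite val_enum_ord iota_ltn_sorted.
have <- : [seq i <- enum 'I_n | i \in t] = t; last exact: filter_subseq.
have srt : sorted (relpre val ltn) t by rewrite -sorted_map.
apply: (irr_sorted_eq (leT := relpre val ltn)) => //.
- by move=> ? ? ?; exact: ltn_trans.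
- by move=> ?; exact: ltnn.
- apply: sorted_filter; first by move=> ? ? ?; exact: ltn_trans.
  by rewrite -sorted_map val_enum_ord iota_ltn_sorted.
- by move=> i; rewrite mem_filter mem_enum andbT.
Qed.

Lemma subseq_map_enum (T : eqType) (f : 'I_n -> T) t : subseq t (map f (enum 'I_n)) ->
  exists2 t', sorted ltn (map val t') & t = map f t'.
Proof.
case/subseqP => m sm ->; exists (mask m (enum 'I_n)); last by rewrite map_mask.
by rewrite -sub_enum_ord mask_subseq.
Qed.

Lemma labelled_block (T : eqType) (f : 'I_n -> T) P V i :
  partition P [set: 'I_n] -> labelled_by f P -> V \in P -> i \in V ->
  forall j, (j \in V) = (f i == f j).
Proof. by case/and3P => _ tP _ fP VP iV j; rewrite -fP (def_pblock tP VP iV). Qed.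

Lemma labelled_mem (T : eqType) (f : 'I_n -> T) P i :
  partition P [set: 'I_n] -> labelled_by f P -> pblock P i \in P /\ i \in pblock P i.
Proof.
by case/and3P => /eqP cP _ _ fP; rewrite pblock_mem ?cP ?inE // mem_pblock cP inE.
Qed.

Lemma noncrossing_labelled (T : eqType) (f : 'I_n -> T) P :
  partition P [set: 'I_n] -> labelled_by f P ->
  noncrossing P <-> noncrossing_seq (map f (enum 'I_n)).
Proof.
move=> pP fP; split=> [nc a b /subseq_map_enum[t]|nc].
  case: t => [|i [|j [|k [|l [|? ?]]]]] //= /and4P[ij jk kl _] [-> -> fik fjl].
  have [VP iV] := labelled_mem i pP fP; have [WP jW] := labelled_mem j pP fP.
  move/forall_inP/(_ _ VP)/forall_inP/(_ _ WP)/forall_inP/(_ _ iV)/forall_inP: nc.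
  move/(_ _ jW)/forall_inP/(_ k); rewrite fP fik eqxx => /(_ isT)/forall_inP/(_ l).
  rewrite fP fjl eqxx ij jk kl => /(_ isT)/= /eqP VW.
  by apply/eqP; rewrite -fik -fjl -fP VW.
have blk := labelled_block pP fP.
apply/forall_inP => V VP; apply/forall_inP => W WP; apply/forall_inP => i iV.
apply/forall_inP => j jW; apply/forall_inP => k kV; apply/forall_inP => l lW.
apply/implyP => /and3P[ij jk kl].
have /nc fij : subseq [:: f i; f j; f i; f j] (map f (enum 'I_n)).
  have fik : f i = f k by apply/eqP; rewrite -(blk V).
  have fjl : f j = f l by apply/eqP; rewrite -(blk W).
  rewrite {2}fik {2}fjl; apply: (@map_subseq _ _ f [:: i; j; k; l]).
  by rewrite sub_enum_ord /= ij jk kl.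
by apply/eqP/setP => m; rewrite (blk V i) // (blk W j) // fij.
Qed.

Lemma interval_labelled (T : eqType) (f : 'I_n -> T) P :
  partition P [set: 'I_n] -> labelled_by f P ->
  [forall V in P, forall i in V, forall k in V, forall j : 'I_n,
     (i <= j <= k)%N ==> (j \in V)] <-> interval_seq (map f (enum 'I_n)).
Proof.
move=> pP fP; split=> [iv a b /subseq_map_enum[t]|iv].
  case: t => [|i [|j [|k [|? ?]]]] //= /and3P[ij jk _] [-> -> fik].
  have [VP iV] := labelled_mem i pP fP.
  move/forall_inP/(_ _ VP)/forall_inP/(_ _ iV)/forall_inP/(_ k): iv.
  rewrite fP fik eqxx => /(_ isT)/forallP/(_ j).
  by rewrite (ltnW ij) (ltnW jk) fP fik => /eqP ->.
have blk := labelled_block pP fP.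
apply/forall_inP => V VP; apply/forall_inP => i iV; apply/forall_inP => k kV.
apply/forallP => j; apply/implyP => /andP[].
rewrite leq_eqVlt => /orP[/eqP/val_inj<- //|ij].
rewrite leq_eqVlt => /orP[/eqP/val_inj-> //|jk].
rewrite (blk V i) //; apply/eqP/iv.
have fik : f i = f k by apply/eqP; rewrite -(blk V).
rewrite {2}fik; apply: (@map_subseq _ _ f [:: i; j; k]).
by rewrite sub_enum_ord /= ij jk.
Qed.

End Partitions.

Lemma valid_true o i d w : valid o i d w -> valid true true d w.
Proof.
elim: w d => //= a w IHw d /andP[ok /IHw->]; rewrite andbT.
by move: ok; rewrite /allowed; case: a.1 => //; rewrite if_same.
Qed.

Section PartitionWords.
Variable n : nat.
Implicit Types (P : {set {set 'I_n}}) (w : seq letter).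

Definition word P := profile [::] [seq pblock P i | i <- enum 'I_n].

Lemma open_stack_nil (T : eqType) (s : seq T) :
  noncrossing_seq s -> open_stack [::] [::] s.
Proof. by []. Qed.

Lemma NC_open_stack P : P \in NC n ->
  open_stack [::] [::] [seq pblock P i | i <- enum 'I_n].
Proof.
rewrite inE => /andP[pP ncP]; apply: open_stack_nil.
exact/(noncrossing_labelled pP (labelled_pblock pP)).
Qed.

Lemma word_NC P : P \in NC n -> word P \in words true true 0 n.
Proof.
move/NC_open_stack => op; rewrite mem_words size_profile size_map size_enum_ord eqxx.
exact: profile_valid op.
Qed.

(** The word determines the positions of the first occurrences of the blocks, and
    so which points share a block. *)
Lemma word_inj : {in NC n &, injective word}.
Proof.
move=> P Q PNC QNC PQ.
have pP : partition P [set: 'I_n] by move: PNC; rewrite inE => /andP[].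
have pQ : partition Q [set: 'I_n] by move: QNC; rewrite inE => /andP[].
apply: (labelled_inj pP pQ (labelled_pblock pP) (labelled_pblock pQ)) => i j.
have E R : R \in NC n -> labels 0 [::] (word R) =
    [seq index (pblock R i) [seq pblock R i | i <- enum 'I_n] | i <- enum 'I_n].
  by move=> /NC_open_stack/labels_profile; rewrite /= -(map_comp _ (pblock R)).
have /eq_in_map {}E := etrans (esym (E P PNC)) (etrans (congr1 (labels 0 [::]) PQ) (E Q QNC)).
have idx R x y : (index (pblock R x) [seq pblock R i | i <- enum 'I_n] ==
    index (pblock R y) [seq pblock R i | i <- enum 'I_n]) = (pblock R x == pblock R y).
  apply/eqP/eqP => [e|->//]; apply: (index_inj set0) e; apply/mapP;
    by [exists x; rewrite ?mem_enum | exists y; rewrite ?mem_enum].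
by rewrite -!idx; move: (E i (mem_enum _ _)) (E j (mem_enum _ _)) => /= -> ->.
Qed.

Lemma labelled_word (T : eqType) (f : 'I_n -> T) P : labelled_by f P ->
  partition P [set: 'I_n] -> word P = profile [::] [seq f i | i <- enum 'I_n].
Proof.
move=> fP pP; suff H r s : profile (map (pblock P) r) (map (pblock P) s) =
    profile (map f r) (map f s) by exact: (H [::]).
have memE i t : (pblock P i \in map (pblock P) t) = (f i \in map f t).
  by elim: t => //= j t IHt; rewrite !inE -(labelled_pblock pP) fP IHt.
by elim: s r => //= i s IHs r; rewrite !memE (IHs (i :: r)).
Qed.

Lemma word_surj w : w \in words true true 0 n -> exists2 P, P \in NC n & word P = w.
Proof.
rewrite mem_words => /andP[/eqP sw vw].
pose f (i : 'I_n) := nth 0 (labels 0 [::] w) i.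
have fE : [seq f i | i <- enum 'I_n] = labels 0 [::] w.
  rewrite /f (map_comp (nth 0 _) val) val_enum_ord -[RHS](mkseq_nth 0).
  by rewrite size_labels sw.
pose P := preim_partition f [set: 'I_n].
have pP : partition P [set: 'I_n] by exact: preim_partitionP.
have fP : labelled_by f P by exact: labelled_preim.
exists P; last by rewrite (labelled_word fP pP) fE (@profile_labels 0 [::]).
rewrite inE pP; apply/(noncrossing_labelled pP fP); rewrite fE.
exact: (@labels_noncrossing 0 [::]).
Qed.

Lemma word_Int P : P \in NC n -> (P \in IntNC n) = (word P \in words true false 0 n).
Proof.
move=> PNC; have op := NC_open_stack PNC.
have pP : partition P [set: 'I_n] by move: (PNC); rewrite inE => /andP[].
rewrite inE PNC mem_words size_profile size_map size_enum_ord eqxx.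
have iP := interval_labelled pP (labelled_pblock pP).
have vP := profile_interval op isT.
by apply/idP/idP => [/iP/vP|/vP/iP].
Qed.

(** The words of length [n] parametrize [NC n]; any family of partitions that is
    recognized on words can be summed over words. *)
Lemma big_word (V : nmodType) (phi : seq letter -> V) (D : {set {set {set 'I_n}}}) ws :
  uniq ws -> {subset D <= NC n} -> {subset ws <= words true true 0 n} ->
  {in NC n, forall P, (P \in D) = (word P \in ws)} ->
  (\sum_(P in D) phi (word P) = \sum_(w <- ws) phi w)%R.
Proof.
move=> uws DNC wsw Dws; rewrite -big_enum -(big_map word predT phi) /=.
apply: perm_big; apply: uniq_perm => // [|w].
  rewrite map_inj_in_uniq ?enum_uniq // => P Q; rewrite !mem_enum => /DNC PD /DNC QD.
  exact: word_inj.
apply/mapP/idP => [[P]|wws]; first by rewrite mem_enum => PD ->; rewrite -Dws ?DNC.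
by have [P PNC wP] := word_surj (wsw w wws); exists P; rewrite // mem_enum Dws // wP.
Qed.

Lemma big_NC (V : nmodType) (phi : seq letter -> V) :
  (\sum_(P in NC n) phi (word P) = \sum_(w <- words true true 0 n) phi w)%R.
Proof.
by apply: big_word => // [|P PNC]; [exact: words_uniq | rewrite PNC word_NC].
Qed.

Lemma big_IntNC (V : nmodType) (phi : seq letter -> V) :
  (\sum_(P in IntNC n) phi (word P) = \sum_(w <- words true false 0 n) phi w)%R.
Proof.
apply: big_word => [|P|w|]; [exact: words_uniq | by rewrite inE => /andP[] | | exact: word_Int].
by rewrite !mem_words => /andP[-> /valid_true].
Qed.

End PartitionWords.

(** The words of the partitions in which the first and the last point share a
    block: after the opening of that block, nothing may start at depth 0. *)
Definition outer_words (n : nat) : seq (seq letter) :=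
  if n is 0 then [:: [:: (false, false)]]
  else [seq (false, true) :: w | w <- words false true 1 n].

Lemma outer_words_uniq n : uniq (outer_words n).
Proof. by case: n => // n; rewrite map_inj_uniq ?words_uniq // => w w' []. Qed.

Lemma word_outer n (P : {set {set 'I_n.+1}}) : P \in NC n.+1 ->
  (ord_max \in outer_block P) = (word P \in outer_words n).
Proof.
move=> PNC; have pP : partition P [set: 'I_n.+1] by move: (PNC); rewrite inE => /andP[].
have := NC_open_stack PNC; rewrite /outer_block (labelled_pblock pP) /word.
have : last (pblock P ord0) [seq pblock P i | i <- enum 'I_n.+1] = pblock P ord_max.
  by rewrite last_map enum_ordSr last_rcons.
rewrite enum_ordSl /= -map_comp => <-; set s := map _ _; set x := pblock P ord0.
have ss : size s = n by rewrite size_map size_enum_ord.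
move=> /open_stack_next; rewrite /next_letter /=.
case: n P PNC pP @x @s ss => [|n] P PNC pP x s ss.
  by rewrite (size0nil ss) /= eqxx.
have s0 : s != [::] by case: (s) ss.
have [xs|xs] := boolP (x \in s) => op; last first.
  transitivity false; last by apply/esym/mapP => -[].
  by apply: contraNF xs => /eqP xs; case: (s) s0 xs => //= y t _ ->; exact: mem_last.
rewrite mem_map => [|w w' []//]; rewrite mem_words size_profile ss eqxx.
by rewrite (@profile_last _ [::] x) //= s0 andbT eq_sym.
Qed.

Lemma big_outer n (V : nmodType) (phi : seq letter -> V) :
  (\sum_(P in NC n.+1 | ord_max \in outer_block P) phi (word P) =
   \sum_(w <- outer_words n) phi w)%R.
Proof.
rewrite -(big_word phi (D := [set P in NC n.+1 | ord_max \in outer_block P])).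
- by apply: eq_bigl => P; rewrite inE.
- exact: outer_words_uniq.
- by move=> P; rewrite inE => /andP[].
- case: n => [|n] w; first by rewrite inE => /eqP->.
  case/mapP => v + ->.
  by rewrite !mem_words => /andP[/eqP<- /valid_true vv] /=; rewrite eqxx vv.
- by move=> P PNC; rewrite inE PNC word_outer.
Qed.

Import GRing.Theory.
Local Open Scope ring_scope.

(** * Cutting a word *)

Section Cut.
Variables (T : Type) (V : nmodType).
Implicit Types (u v w : seq T).

Definition cut (phi : seq T -> seq T -> V) w : V :=
  \sum_(k < (size w).+1) phi (take k w) (drop k w).

Lemma cut_nil phi : cut phi [::] = phi [::] [::].
Proof. by rewrite /cut big_ord1. Qed.

Lemma cut_cons phi a w :
  cut phi (a :: w) = phi [::] (a :: w) + cut (fun u => phi (a :: u)) w.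
Proof. by rewrite /cut big_ord_recl. Qed.

Lemma cut_rcons phi w a :
  cut phi (rcons w a) = cut (fun u v => phi u (rcons v a)) w + phi (rcons w a) [::].
Proof.
elim: w phi => [|b w IHw] phi /=; first by rewrite cut_cons !cut_nil.
by rewrite !cut_cons IHw addrA.
Qed.

Lemma eq_cut_in phi psi w :
  (forall u v, w = u ++ v -> phi u v = psi u v) -> cut phi w = cut psi w.
Proof. by move=> E; apply: eq_bigr => k _; apply: E; rewrite cat_take_drop. Qed.

Lemma eq_cut phi psi w : (forall u v, phi u v = psi u v) -> cut phi w = cut psi w.
Proof. by move=> E; apply: eq_cut_in. Qed.

Lemma cutD phi psi w : cut (fun u v => phi u v + psi u v) w = cut phi w + cut psi w.
Proof. exact: big_split. Qed.

Lemma cut0 w : cut (fun _ _ => 0) w = 0.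
Proof. exact: big1. Qed.

Lemma cut_last phi w : (forall u a v, phi u (a :: v) = 0) -> cut phi w = phi w [::].
Proof.
elim: w phi => [|a w IHw] phi phi0; first by rewrite cut_nil.
by rewrite cut_cons phi0 add0r IHw.
Qed.

Lemma cut_first phi w : (forall u a v, phi (a :: u) v = 0) -> cut phi w = phi [::] w.
Proof.
case: w => [|a w] phi0; first by rewrite cut_nil.
by rewrite cut_cons (eq_cut _ (psi := fun _ _ => 0)) ?cut0 ?addr0.
Qed.

(** Both sides sum over the ways to cut the word into three parts. *)
Lemma cutA (phi : seq T -> seq T -> seq T -> V) w :
  cut (fun u v => cut (fun s t => phi u s t) v) w =
  cut (fun u v => cut (fun s t => phi s t v) u) w.
Proof.
elim: w phi => [|a w IHw] phi; first by rewrite !cut_nil.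
rewrite !cut_cons IHw cut_nil -addrA -cutD; congr (_ + _).
by apply: eq_cut => u v; rewrite cut_cons.
Qed.

(** A cut that isolates one letter: it is the coefficient that follows a closed
    call, and gets multiplied with the value of that call. *)
Definition cut1 (phi : seq T -> T -> seq T -> V) w : V :=
  cut (fun u v => if v is t :: v' then phi u t v' else 0) w.

Lemma cut1_nil phi : cut1 phi [::] = 0.
Proof. exact: cut_nil. Qed.

Lemma cut1_cons phi a w :
  cut1 phi (a :: w) = phi [::] a w + cut1 (fun u => phi (a :: u)) w.
Proof. exact: cut_cons. Qed.

Lemma eq_cut1 phi psi w : (forall u t v, phi u t v = psi u t v) -> cut1 phi w = cut1 psi w.
Proof. by move=> E; apply: eq_cut => u [|t v]. Qed.

Lemma cut1D phi psi w :
  cut1 (fun u t v => phi u t v + psi u t v) w = cut1 phi w + cut1 psi w.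
Proof. by rewrite /cut1 -cutD; apply: eq_cut => u [|t v] //; rewrite addr0. Qed.

Lemma cut_cut1 (phi : seq T -> T -> seq T -> seq T -> V) w :
  cut (fun u v => cut1 (fun q t r => phi q t r v) u) w =
  cut1 (fun q t r => cut (fun u v => phi q t u v) r) w.
Proof.
elim: w phi => [|a w IHw] phi; first by rewrite cut_nil !cut1_nil.
rewrite cut_cons cut1_nil add0r cut1_cons -IHw -cutD.
by apply: eq_cut => u v; rewrite cut1_cons.
Qed.

Lemma cut1A (phi : seq T -> T -> seq T -> T -> seq T -> V) w :
  cut1 (fun q t r => cut1 (fun u s v => phi q t u s v) r) w =
  cut1 (fun u s v => cut1 (fun q t r => phi q t r s v) u) w.
Proof.
elim: w phi => [|a w IHw] phi; first by rewrite !cut1_nil.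
rewrite !cut1_cons IHw cut1_nil add0r -cut1D.
by apply: eq_cut1 => u s v; rewrite cut1_cons.
Qed.

End Cut.

Lemma cut_map (T U : Type) (V : nmodType) (h : T -> U) (phi : seq U -> seq U -> V) w :
  cut phi (map h w) = cut (fun u v => phi (map h u) (map h v)) w.
Proof.
elim: w phi => [|a w IHw] phi; first by rewrite !cut_nil.
by rewrite /= !cut_cons IHw.
Qed.

Lemma mulr_cut (T : Type) (R : pzSemiRingType) (c : R) phi (w : seq T) :
  c * cut phi w = cut (fun u v => c * phi u v) w.
Proof. exact: mulr_sumr. Qed.

Lemma cut_mulr (T : Type) (R : pzSemiRingType) (c : R) phi (w : seq T) :
  cut phi w * c = cut (fun u v => phi u v * c) w.
Proof. exact: mulr_suml. Qed.

(** * Pieces of a word *)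

Section Pieces.
Variable T : Type.
Implicit Types (a : T) (w : seq T) (ps : seq (seq T)).

(** The default case keeps the result nonempty, which makes [big_pieces_linear]
    hold without any condition on the list of pieces. *)
Definition glue a ps : seq (seq T) :=
  if ps is p :: ps' then (a :: p) :: ps' else [:: [:: a]].

Fixpoint pieces w : seq (seq (seq T)) :=
  match w with
  | [::] => [:: [::]]
  | [:: a] => [:: [:: [:: a]]]
  | a :: w' => [seq [:: a] :: ps | ps <- pieces w'] ++ [seq glue a ps | ps <- pieces w']
  end.

Variable V : nmodType.

Lemma big_pieces_nil (phi : seq (seq T) -> V) : \sum_(ps <- pieces [::]) phi ps = phi [::].
Proof. exact: big_seq1. Qed.

Lemma big_pieces_cons2 (phi : seq (seq T) -> V) a b w :
  \sum_(ps <- pieces [:: a, b & w]) phi ps =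
  \sum_(ps <- pieces (b :: w)) phi ([:: a] :: ps) +
  \sum_(ps <- pieces (b :: w)) phi (glue a ps).
Proof. by rewrite [pieces _]/= big_cat !big_map. Qed.

Lemma big_pieces_cons (phi : seq (seq T) -> V) a w :
  \sum_(ps <- pieces (a :: w)) phi ps =
  cut (fun u v => \sum_(ps <- pieces v) phi ((a :: u) :: ps)) w.
Proof.
elim: w a phi => [|b w IHw] a phi; first by rewrite cut_nil !big_seq1.
by rewrite big_pieces_cons2 (IHw b (phi \o glue a)) cut_cons.
Qed.

(** Cutting the list of the pieces of a word is the same as cutting the word and
    decomposing both halves. *)
Lemma big_pieces_cut (phi : seq (seq T) -> seq (seq T) -> V) w :
  \sum_(ps <- pieces w) cut phi ps =
  cut (fun u v => \sum_(ps <- pieces u) \sum_(qs <- pieces v) phi ps qs) w.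
Proof.
have [n] := ubnP (size w); elim: n w phi => // n IHn [|a w] phi /ltnSE sw.
  by rewrite big_pieces_nil !cut_nil !big_pieces_nil.
rewrite big_pieces_cons cut_cons big_pieces_nil big_pieces_cons -[RHS]addrC.
under [X in _ = X + _]eq_cut do rewrite big_pieces_cons.
rewrite -cutA -cutD; apply: eq_cut_in => u v wuv.
under eq_bigr do rewrite cut_cons.
rewrite big_split addrC /= IHn //.
by apply: leq_trans sw; rewrite wuv /= size_cat ltnS leq_addl.
Qed.

Lemma big_pieces0 (phi : seq (seq T) -> V) w :
  (forall ps, (size ps <= size w)%N -> phi ps = 0) -> \sum_(ps <- pieces w) phi ps = 0.
Proof.
elim: w phi => [|a [|b w] IHw] phi phi0; rewrite ?big_seq1 ?phi0 //.
rewrite big_pieces_cons2 !IHw ?addr0 // => ps sps; apply: phi0 => //.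
by case: ps sps => //= p ps /leqW.
Qed.

(** Only the decomposition into single letters has as many pieces as the word has
    letters. This makes substitution triangular in its outer series. *)
Lemma big_pieces_lead (phi : seq (seq T) -> V) w :
  (forall ps, (size ps < size w)%N -> phi ps = 0) ->
  \sum_(ps <- pieces w) phi ps = phi [seq [:: a] | a <- w].
Proof.
elim: w phi => [|a [|b w] IHw] phi phi0; rewrite ?big_seq1 //.
rewrite big_pieces_cons2 IHw => [|ps sps]; last exact: phi0.
rewrite big_pieces0 ?addr0 // => ps sps; apply: phi0.
by case: ps sps => //= p ps; rewrite ltnS.
Qed.

End Pieces.

(** * The algebra of series *)

Section Series.
Variables (K : fieldType) (B : algType K).
Local Notation series := (bseries B).
Implicit Types (f g h x y : series) (w : seq B).

(** Series of multilinear maps behave as formal power series in which the word of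
    arguments plays the role of the power of the variable: [prods] is the product
    and [comps] the substitution. *)
Definition prods f g : series := cut (fun u v => f u * g v).

Definition comps f g : series := fun w => \sum_(ps <- pieces w) f (map g ps).

(** The left derivative along a letter; products and substitutions are computed by
    recursion on the word through it. *)
Definition partial (b : B) f : series := fun w => f (b :: w).

(** With I the series that is the identity on words of one letter and vanishes
    elsewhere, this is I + I b x. Its fixed point I + I b I + I b I b I + ... is the
    moment series whose B-transform is [b]. *)
Definition mom_op (b x : series) : series :=
  fun w => if w is c :: w' then c * ((nilp w')%:R + prods b x w') else 0.

Lemma prods_nil f g : prods f g [::] = f [::] * g [::].
Proof. exact: cut_nil. Qed.

Lemma prods_cons f g a w :
  prods f g (a :: w) = f [::] * g (a :: w) + prods (partial a f) g w.
Proof. exact: cut_cons. Qed.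

Lemma prodsA f g h : prods f (prods g h) = prods (prods f g) h.
Proof.
apply/funext => w; rewrite /prods; under eq_cut do rewrite mulr_cut.
rewrite cutA; apply: eq_cut => u v; rewrite cut_mulr.
by apply: eq_cut => s t; rewrite mulrA.
Qed.

Lemma prodsDl f g h w : prods (f \+ g) h w = prods f h w + prods g h w.
Proof. by rewrite /prods -cutD; apply: eq_cut => u v; rewrite mulrDl. Qed.

Lemma prodsDr f g h w : prods f (g \+ h) w = prods f g w + prods f h w.
Proof. by rewrite /prods -cutD; apply: eq_cut => u v; rewrite mulrDr. Qed.

Lemma comps_nil f g : comps f g [::] = f [::].
Proof. exact: big_pieces_nil. Qed.

Lemma comps_cons f g a w :
  comps f g (a :: w) = cut (fun u v => comps (partial (g (a :: u)) f) g v) w.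
Proof. exact: big_pieces_cons. Qed.

Lemma comps_letter f g a : comps f g [:: a] = f [:: g [:: a]].
Proof. exact: big_seq1. Qed.

Lemma compsD f g h : comps (f \+ g) h = comps f h \+ comps g h.
Proof. by apply/funext => w; rewrite /comps big_split. Qed.

Lemma comps_linear (alpha : {linear B -> B}) f g :
  comps (alpha \o f) g = alpha \o comps f g.
Proof. by apply/funext => w; rewrite /= linear_sum. Qed.

Lemma comps_cut (phi : seq B -> seq B -> B) h w :
  comps (cut phi) h w =
  cut (fun u v => \sum_(ps <- pieces u) \sum_(qs <- pieces v) phi (map h ps) (map h qs)) w.
Proof.
rewrite /comps; under eq_bigr do rewrite cut_map.
exact: (big_pieces_cut (fun ps qs => phi (map h ps) (map h qs))).
Qed.

(** A cut of the list of the pieces amounts to a cut of the word together with a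
    decomposition of either half. *)
Lemma comps_prods f g h : comps (prods f g) h = prods (comps f h) (comps g h).
Proof.
apply/funext => w; rewrite comps_cut; apply: eq_cut => u v.
rewrite mulr_suml; apply: eq_bigr => ps _; exact/esym/mulr_sumr.
Qed.

Lemma multilinear_partial b f : multilinear f -> multilinear (partial b f).
Proof. by move=> Fl u v; exact: (Fl (b :: u) v). Qed.

Lemma multilinear_sumr (I : Type) (r : seq I) (F : I -> B) f u v : multilinear f ->
  f (u ++ (\sum_(i <- r) F i) :: v) = \sum_(i <- r) f (u ++ F i :: v).
Proof.
move=> fl; apply: (big_morph (fun b => f (u ++ b :: v))) => [b c|].
  exact: multilinearD.
exact: multilinear0.
Qed.

Lemma comps_partial_sum (I : Type) (r : seq I) (F : I -> B) f g w : multilinear f ->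
  comps (partial (\sum_(i <- r) F i) f) g w = \sum_(i <- r) comps (partial (F i) f) g w.
Proof.
move=> fl; rewrite /comps exchange_big; apply: eq_bigr => ps _.
exact: (multilinear_sumr r F [::]).
Qed.

Lemma comps_partial_cut (phi : seq B -> seq B -> B) u f g w : multilinear f ->
  comps (partial (cut phi u) f) g w = cut (fun s t => comps (partial (phi s t) f) g w) u.
Proof. exact: comps_partial_sum. Qed.

(** A decomposition into pieces that are decomposed in turn is a decomposition
    whose pieces are then grouped. Multilinearity of [f] is what moves the inner
    sums out of its arguments. *)
Lemma compsA f g h : multilinear f -> comps f (comps g h) = comps (comps f g) h.
Proof.
move=> fl; apply/funext => w.
have [n] := ubnP (size w); elim: n w f fl => // n IHn [|a w] f fl /ltnSE sw.
  by rewrite !comps_nil.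
rewrite !comps_cons.
have E b : partial b (comps f g) =
    cut (fun s t => comps (partial (g (b :: s)) f) g t).
  by apply/funext => s; rewrite /partial comps_cons.
under [RHS]eq_cut do rewrite E comps_cut.
rewrite cutA; apply: eq_cut_in => u v wuv.
have sv : (size v < n)%N.
  by apply: leq_trans sw; rewrite wuv /= size_cat ltnS leq_addl.
rewrite comps_cons comps_partial_cut //; apply: eq_cut => s t.
rewrite comps_partial_sum //; apply: eq_bigr => ps _.
by rewrite IHn //; exact: multilinear_partial.
Qed.

Lemma big_pieces_nilp w : \sum_(ps <- pieces w) (nilp ps)%:R = (nilp w)%:R :> B.
Proof.
case: w => [|a w]; first exact: big_seq1.
by rewrite big_pieces_cons [LHS](eq_cut _ (psi := fun _ _ => 0)) ?cut0 // => u v; exact: big1.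
Qed.

(** Substituting [h] in f = I + I b f turns I into [h], by right distributivity. *)
Lemma mom_op_comps b f h : h [::] = 0 -> f = mom_op b f ->
  comps f h = h \+ prods h (prods (comps b h) (comps f h)).
Proof.
move=> h0 fE; rewrite -comps_prods; apply/funext => -[|a w] /=.
  by rewrite comps_nil prods_nil h0 mul0r addr0 fE.
rewrite {1}fE comps_cons prods_cons h0 mul0r add0r.
have -> : h (a :: w) = cut (fun u v => h (a :: u) * (nilp v)%:R) w.
  by rewrite cut_last ?mulr1 // => u c v; rewrite mulr0.
rewrite /prods -cutD; apply: eq_cut => u v.
rewrite -mulrDr -(big_pieces_nilp v) -big_split mulr_sumr.
by apply: eq_bigr => ps _; rewrite /partial /= {1}/nilp size_map.
Qed.

(** The resolvent identity: k solves k = I + I a k, and perturbing [a] by [q]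
    gives x = k + k q x. *)
Lemma mom_op_resolvent a q k x : k = mom_op a k -> x = k \+ prods k (prods q x) ->
  x = mom_op (a \+ q) x.
Proof.
move=> kE xE; apply/funext => -[|c w]; rewrite {1}xE /=.
  by rewrite prods_nil kE /= mul0r addr0.
set y := prods q x; rewrite prods_cons {1 2}kE /= mul0r add0r.
have -> : partial c k = fun u => c * ((nilp u)%:R + prods a k u).
  by rewrite {1}kE.
have -> : prods (fun u => c * ((nilp u)%:R + prods a k u)) y w =
    c * (y w + prods (prods a k) y w).
  have -> : y w = prods (fun u => (nilp u)%:R) y w.
    by rewrite /prods cut_first ?mul1r // => d u v; rewrite mul0r.
  by rewrite -prodsDl mulr_cut; apply: eq_cut => u v; rewrite mulrA.
have -> : prods (a \+ q) x w = prods a k w + prods (prods a k) y w + y w.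
  by rewrite prodsDl {1}xE prodsDr -prodsA.
by rewrite -mulrDr -!addrA [y w + _]addrC.
Qed.

(** * Fixed points *)

(** Such an operator fixes the values of its fixed point one length of words after
    the other, so that it has exactly one. All transforms are obtained in this
    way. *)
Definition contractive (op : series -> series) := forall n x y,
  (forall w, size w < n -> x w = y w)%N -> forall w, (size w <= n)%N -> op x w = op y w.

(** The value at a word is stable after as many iterations as its length, plus
    one. *)
Definition sfix (op : series -> series) : series :=
  fun w => iter (size w).+1 op (fun _ => 0) w.

Lemma sfix_iter op n w : contractive op -> (size w < n)%N ->
  iter n op (fun _ => 0) w = sfix op w.
Proof.
move=> opc; rewrite /sfix; set z := fun _ => 0.
suff H m k v : (size v < m)%N -> (size v < k)%N -> iter m op z v = iter k op z v.
  by move=> wn; apply: H.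
elim: m k v => // m IHm [//|k] v vm vk /=.
by apply: (opc (size v)) => // u uv; apply: IHm; apply: leq_trans uv _.
Qed.

Lemma sfixE op : contractive op -> sfix op = op (sfix op).
Proof.
move=> opc; apply/funext => w; rewrite {1}/sfix /=.
by apply: (opc (size w)) => // v vw; exact: sfix_iter.
Qed.

Lemma contractive_unique op x y : contractive op -> x = op x -> y = op y -> x = y.
Proof.
move=> opc xE yE; apply/funext => w.
have [n] := ubnP (size w); elim: n w => // n IHn w wn.
by rewrite xE yE; apply: (opc n) => // v; exact: IHn.
Qed.

Lemma sfix_multilinear op : contractive op ->
  (forall x, multilinear x -> multilinear (op x)) -> multilinear (sfix op).
Proof.
move=> opc opl u v c a b; set n := (size (u ++ a :: v)).+1.
have l : multilinear (iter n op (fun _ => 0)).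
  elim: n => [|n IHn] /=; last exact: opl.
  by move=> ? ? ? ? ? /=; rewrite scaler0 addr0.
by have := l u v c a b; rewrite !sfix_iter // /n !size_cat /= ltnSn.
Qed.

Lemma eq_prods f f' g g' w :
  (forall v, size v <= size w -> f v = f' v)%N ->
  (forall v, size v <= size w -> g v = g' v)%N -> prods f g w = prods f' g' w.
Proof.
move=> ff gg; apply: eq_cut_in => u v wuv.
by rewrite ff ?gg // wuv size_cat ?leq_addl ?leq_addr.
Qed.

Lemma eq_comps f g g' w :
  (forall v, size v <= size w -> g v = g' v)%N -> comps f g w = comps f g' w.
Proof.
have [n] := ubnP (size w); elim: n w f => // n IHn [|a w] f /ltnSE sw gg.
  by rewrite !comps_nil.
rewrite !comps_cons; apply: eq_cut_in => u v wuv.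
have sz : size w = (size u + size v)%N by rewrite wuv size_cat.
rewrite gg; last by rewrite /= sz ltnS leq_addr.
apply: IHn => [|s sv]; first by apply: leq_trans sw; rewrite /= sz ltnS leq_addl.
by apply: gg; rewrite (leq_trans sv) //= sz ltnW // ltnS leq_addl.
Qed.

(** The term of [comps f g w] with the shortest pieces is [f w] itself, and all the
    others evaluate [f] on shorter words. *)
Lemma comps_contractive g : (forall a, g [:: a] = a) ->
  contractive (fun f w => f w - comps f g w).
Proof.
move=> g1 n f f' ff w wn.
have : comps (f \- f') g w = (f \- f') w.
  rewrite /comps big_pieces_lead => [|ps psw] /=.
    by rewrite -map_comp map_id_in // => a _ /=; rewrite g1.
  by rewrite ff ?subrr // size_map (leq_trans psw).
rewrite /comps sumrB /= => E; apply/eqP; rewrite -subr_eq0 opprB [X in _ + X]addrC.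
by rewrite addrACA -E addrACA subrr addNr addr0.
Qed.

(** Weaker than [contractive]: values at words of the same length may be used,
    since [mom_op] adds one letter. *)
Definition causal (op : series -> series) := forall x y w,
  (forall v, size v <= size w -> x v = y v)%N -> op x w = op y w.

Lemma mom_op_contractive (b : series -> series) :
  causal b -> contractive (fun x => mom_op (b x) x).
Proof.
move=> bc n x y xy [|c w] //= sw; congr (_ * (_ + _)).
have xy' v : (size v <= size w)%N -> x v = y v by move=> vw; apply: xy; exact: leq_trans sw.
apply: eq_prods => // v vw; apply: bc => u uv.
by apply: xy'; exact: leq_trans vw.
Qed.

Lemma comps_causal f : causal (comps f).
Proof. by move=> x y w xy; exact: eq_comps. Qed.

Lemma causalD a b : causal b -> causal (fun x => a \+ b x).
Proof. by move=> bc x y w xy /=; rewrite (bc x y). Qed.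

Lemma contractive_addl g op : contractive op -> contractive (fun x => g \+ op x).
Proof. by move=> opc n x y xy w wn /=; rewrite (opc n x y). Qed.

(** The cut before the final letter contributes [f w], and all the other cuts
    evaluate [f] on shorter words. *)
Lemma prods_contractive m : m [::] = 0 -> (forall a, m [:: a] = a) ->
  contractive (fun f w => f w - prods f m (rcons w 1)).
Proof.
move=> m0 m1 n f f' ff w wn.
have E h : h w - prods h m (rcons w 1) =
    - cut1 (fun u t v => h u * m (rcons (t :: v) 1)) w.
  rewrite /prods cut_rcons m0 mulr0 addr0.
  have -> : cut (fun u v => h u * m (rcons v 1)) w =
      cut1 (fun u t v => h u * m (rcons (t :: v) 1)) w + h w.
    have -> : h w = cut (fun u v => if v is t :: v' then 0 else h u) w by rewrite cut_last.
    by rewrite /cut1 -cutD; apply: eq_cut => u [|t v]; rewrite ?add0r ?addr0 //= m1 mulr1.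
  by rewrite opprD addrC addrNK.
rewrite !E; congr (- _); apply: eq_cut_in => u [|t v] wuv //.
by rewrite ff //; apply: leq_trans wn; rewrite wuv size_cat /= addnS ltnS leq_addr.
Qed.

(** * Multilinearity *)

Lemma cut_linear (phi : seq B -> seq B -> B) u v :
  (forall s t r, linear (fun b => phi (s ++ b :: t) r)) ->
  (forall r s t, linear (fun b => phi r (s ++ b :: t))) ->
  linear (fun b => cut phi (u ++ b :: v)).
Proof.
move=> l1 l2 c a b; elim: u phi l1 l2 => [|d u IHu] phi l1 l2 /=.
  rewrite !cut_cons (l2 [::] [::]) scalerDr addrACA; congr (_ + _).
  rewrite /cut scaler_sumr -big_split; apply: eq_bigr => k _; exact: (l1 [::]).
rewrite !cut_cons (l2 [::] (d :: u)) (IHu (fun s => phi (d :: s))).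
- by rewrite scalerDr addrACA.
- by move=> s t r; exact: (l1 (d :: s)).
- by move=> r s t; exact: (l2 (d :: r)).
Qed.

Lemma prods_multilinear f g : multilinear f -> multilinear g -> multilinear (prods f g).
Proof.
move=> fl gl u v; apply: cut_linear => [s t r|r s t] c a b.
  by rewrite fl mulrDl -scalerAl.
by rewrite gl mulrDr -scalerAr.
Qed.

Lemma big_pieces_linear (phi : seq (seq B) -> B) u v :
  (forall ps qs s t, linear (fun b => phi (ps ++ (s ++ b :: t) :: qs))) ->
  linear (fun b => \sum_(ps <- pieces (u ++ b :: v)) phi ps).
Proof.
move=> phil c a b; elim: u phi phil => [|d u IHu] phi phil.
  case: v => [|e v]; first by rewrite !big_seq1; exact: (phil [::] [::] [::] [::]).
  rewrite !big_pieces_cons2 scalerDr addrACA; congr (_ + _).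
    rewrite scaler_sumr -big_split; apply: eq_bigr => ps _; exact: (phil [::] ps [::] [::]).
  rewrite scaler_sumr -big_split; apply: eq_bigr => -[|p ps] _.
    exact: (phil [::] [::] [::] [::]).
  exact: (phil [::] ps [::] p).
have E (e : B) : \sum_(ps <- pieces ((d :: u) ++ e :: v)) phi ps =
    \sum_(ps <- pieces (u ++ e :: v)) phi ([:: d] :: ps) +
    \sum_(ps <- pieces (u ++ e :: v)) phi (glue d ps).
  by case: u {IHu} => [|k u]; rewrite big_pieces_cons2.
rewrite !E (IHu (fun ps => phi ([:: d] :: ps))) ?(IHu (fun ps => phi (glue d ps))).
- by rewrite scalerDr addrACA.
- by move=> [|p ps] qs s t; [exact: (phil [::] qs (d :: s) t) |
    exact: (phil ((d :: p) :: ps) qs s t)].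
- by move=> ps qs s t; exact: (phil ([:: d] :: ps) qs s t).
Qed.

Lemma comps_multilinear f g : multilinear f -> multilinear g -> multilinear (comps f g).
Proof.
move=> fl gl u v; apply: big_pieces_linear => ps qs s t c a b.
by rewrite !map_cat /= gl (fl (map g ps)).
Qed.

Lemma mom_op_multilinear b x : multilinear b -> multilinear x -> multilinear (mom_op b x).
Proof.
move=> bl xl [|d u] v c a a' /=; first by rewrite mulrDl -scalerAl.
rewrite /nilp !size_cat !addnS !add0r (prods_multilinear bl xl).
by rewrite mulrDr -scalerAr.
Qed.

End Series.

(** * Reading a string of symbols *)

Lemma big_words (V : nmodType) (phi : seq letter -> V) o i d n :
  \sum_(w <- words o i d n.+1) phi w =
  (if allowed o i d (false, false) then
     \sum_(w <- words o i d n) phi ((false, false) :: w) +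
     \sum_(w <- words o i d.+1 n) phi ((false, true) :: w) else 0) +
  (if (0 < d)%N then
     \sum_(w <- words o i d n) phi ((true, true) :: w) +
     \sum_(w <- words o i d.-1 n) phi ((true, false) :: w) else 0).
Proof.
rewrite wordsS big_allpairs_dep big_filter /letters !big_cons big_nil /=.
rewrite /allowed /=; case: (if d == 0 then o else i); case: (0 < d)%N;
  by rewrite ?addr0 ?add0r ?addrA.
Qed.

Definition letter_symbol (K : fieldType) (B : algType K) (F : bseries B) (a : letter) :
    symbol B :=
  match a with
  | (false, false) => SSingle F
  | (false, true) => SOpen F
  | (true, false) => SClose B
  | (true, true) => SComma B
  end.

Section Reading.
Variables (K : fieldType) (B : algType K).
Local Notation series := (bseries B).
Local Notation frame := (bseries B * seq B * B)%type.
Implicit Types (f g b : series) (w cs : seq B) (fr : frame) (st : seq frame).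

Lemma mom_op_nil b x : x = mom_op b x -> x [::] = 0.
Proof. by move->. Qed.

Lemma mom_op_letter b x a : x = mom_op b x -> x [:: a] = a.
Proof. by move=> xE; rewrite xE /= prods_nil (mom_op_nil xE) mulr0 addr0 mulr1. Qed.

Lemma mom_op_lmul b x a c w : x = mom_op b x -> x (a * c :: w) = a * x (c :: w).
Proof. by move->; rewrite /= mulrA. Qed.

Lemma mom_op_addl b x a c w : x = mom_op b x -> x (a + c :: w) = x (a :: w) + x (c :: w).
Proof. by move->; rewrite /= mulrDl. Qed.

(** The first letter after [a] decides: either a singleton absorbs it, or a block
    is opened whose value is absorbed, with the next coefficient, in the first
    letter. *)
Lemma mom_op_cons2 b x a c w : x = mom_op b x ->
  x [:: a, c & w] = x (a * b [::] * c :: w) +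
    cut1 (fun q t v => x (a * b (c :: q) * t :: v)) w.
Proof.
move=> xE; rewrite {1}xE /= add0r prods_cons mulrDr mulrA -(mom_op_lmul _ _ _ xE).
congr (_ + _); rewrite mulr_cut; apply: eq_cut => u [|t v].
  by rewrite (mom_op_nil xE) !mulr0.
by rewrite (mom_op_lmul _ _ _ xE) mulrA.
Qed.

Lemma additive_cut1 (F : B -> B) phi w : F 0 = 0 -> {morph F : a b / a + b} ->
  F (cut1 phi w) = cut1 (fun u t v => F (phi u t v)) w.
Proof.
move=> F0 FD; rewrite /cut1 /cut (big_morph F FD F0).
by apply: eq_bigr => k _; case: (drop k w).
Qed.

Lemma comps_partialD f x a c w : multilinear f ->
  comps (partial (a + c) f) x w = comps (partial a f) x w + comps (partial c f) x w.
Proof.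
move=> fl; rewrite /comps -big_split; apply: eq_bigr => ps _.
exact: (multilinearD [::] _ _ _ fl).
Qed.

Lemma comps_partial0 f x w : multilinear f -> comps (partial 0 f) x w = 0.
Proof. by move=> fl; apply: big1 => ps _; exact: (multilinear0 [::] _ fl). Qed.

(** The state of a call whose current argument starts with [a] followed by [c]:
    the argument ends after [a], or [a] absorbs a singleton, or it absorbs a whole
    call. *)
Lemma comps_cons2 b x f a c w : x = mom_op b x -> multilinear f ->
  comps f x [:: a, c & w] = comps (partial a f) x (c :: w) +
    (comps f x (a * b [::] * c :: w) +
     cut1 (fun q t v => comps f x (a * b (c :: q) * t :: v)) w).
Proof.
move=> xE fl; rewrite comps_cons cut_cons (mom_op_letter _ xE); congr (_ + _).
have E u v : comps (partial (x [:: a, c & u]) f) x v =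
    comps (partial (x (a * b [::] * c :: u)) f) x v +
    cut1 (fun q t r => comps (partial (x (a * b (c :: q) * t :: r)) f) x v) u.
  rewrite (mom_op_cons2 _ _ _ xE) comps_partialD //; congr (_ + _).
  apply: (additive_cut1 (F := fun z => comps (partial z f) x v)).
    exact: comps_partial0.
  by move=> ? ? /=; rewrite comps_partialD.
under eq_cut do rewrite E.
rewrite cutD -comps_cons cut_cut1; congr (_ + _).
by apply: eq_cut1 => q t v; rewrite comps_cons.
Qed.

Variables (o i : bool) (F x y : series).
Hypothesis F_lin : multilinear F.

(** Forbidding blocks at some level amounts to a vanishing B-transform there. *)
Definition gate (p : bool) f : series := if p then f else fun _ => 0.

Hypothesis xE : x = mom_op (gate i (comps F x)) x.
Hypothesis yE : y = mom_op (gate o (comps F x)) y.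

Fixpoint stack_lin st : Prop :=
  if st is (f, _, _) :: st' then multilinear f /\ stack_lin st' else True.

(** The expected sum of all readings that complete a given state: the innermost
    open call receives the pieces of the word that are read before it is closed,
    each of them evaluated by [x]; the result and the coefficient that follows
    multiply the product to its left, and the reading goes on one level higher. At
    depth 0 the value is given by [y]. *)
Fixpoint stack_value st (cur : B) cs : B :=
  if st is (f, args, before) :: st' then
    cut1 (fun u t v =>
      stack_value st' (before * comps (fun s => f (args ++ s)) x (cur :: u) * t) v) cs
  else y (cur :: cs).

Lemma multilinear_cat f args : multilinear f -> multilinear (fun s => f (args ++ s)).
Proof. by move=> fl u v c a b; rewrite !catA fl. Qed.

Lemma stack_valueD st a c cs : stack_lin st ->
  stack_value st (a + c) cs = stack_value st a cs + stack_value st c cs.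
Proof.
elim: st a c cs => [|[[f args] before] st IHst] a c cs /=.
  by move=> _; rewrite (mom_op_addl _ _ _ yE).
case=> fl stl; rewrite -cut1D; apply: eq_cut1 => u t v.
rewrite -IHst //; congr stack_value; rewrite -mulrDl -mulrDr.
rewrite !comps_cons -cutD; congr (_ * _ * _); apply: eq_cut => r s.
by rewrite (mom_op_addl _ _ _ xE) comps_partialD //; exact: multilinear_cat.
Qed.

Lemma stack_value0 st cs : stack_lin st -> stack_value st 0 cs = 0.
Proof.
by move=> stl; apply: (@addrI _ (stack_value st 0 cs)); rewrite -stack_valueD // !addr0.
Qed.

Lemma stack_value_open (p : bool) st cur c cs : stack_lin st ->
  stack_value st (cur * gate p (comps F x) [::] * c) cs +
    cut1 (fun q t v => stack_value st (cur * gate p (comps F x) (c :: q) * t) v) cs =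
  if p then stack_value st (cur * F [::] * c) cs +
            stack_value ((F, [::], cur) :: st) c cs
  else 0.
Proof.
move=> stl; case: p => /=; first by rewrite comps_nil.
rewrite mulr0 mul0r stack_value0 // add0r /cut1.
rewrite (eq_cut _ (psi := fun _ _ => 0)) ?cut0 // => u [|t v] //.
by rewrite mul0r stack_value0.
Qed.

Lemma stack_value_frame f args before st cur c cs :
  stack_lin ((f, args, before) :: st) ->
  stack_value ((f, args, before) :: st) cur (c :: cs) =
  (if i then stack_value ((f, args, before) :: st) (cur * F [::] * c) cs +
            stack_value [:: (F, [::], cur), (f, args, before) & st] c cs else 0) +
  (stack_value ((f, rcons args cur, before) :: st) c cs +
   stack_value st (before * f (rcons args cur) * c) cs).
Proof.
move=> stl; rewrite -stack_value_open // addrC; case: stl => fl stl /=.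
set g := fun s => f (args ++ s); have gl : multilinear g by exact: multilinear_cat.
rewrite cut1_cons comps_letter (mom_op_letter _ xE) /g cats1 addrC -/g.
rewrite cut1A -!cut1D [RHS]addrAC; congr (_ + _); rewrite -cut1D.
apply: eq_cut1 => u t v; rewrite (comps_cons2 _ _ _ xE) //.
have E : partial cur g = (fun s => f (rcons args cur ++ s)).
  by apply/funext => s; rewrite /partial /g cat_rcons.
rewrite E !mulrDr !mulrDl !stack_valueD //.
rewrite (additive_cut1 (F := fun z => stack_value st (before * z * t) v)); first last.
- by move=> z z' /=; rewrite mulrDr mulrDl stack_valueD.
- by rewrite mulr0 mul0r stack_value0.
by [].
Qed.

Lemma stack_value_nil cur c cs :
  stack_value [::] cur (c :: cs) =
  if o then stack_value [::] (cur * F [::] * c) cs +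
            stack_value [:: (F, [::], cur)] c cs else 0.
Proof. by rewrite -stack_value_open //= (mom_op_cons2 _ _ _ yE). Qed.

Definition words_value (d : nat) (cur : B) st cs : B :=
  \sum_(w <- words o i d (size cs))
     (foldl (@read_symbol K B) (cur, st) (interleave (map (letter_symbol F) w) cs)).1.

(** [stack_value] satisfies the recursion of the readings over the next letter of
    the word. *)
Lemma words_valueE st cur cs : stack_lin st ->
  words_value (size st) cur st cs = stack_value st cur cs.
Proof.
rewrite /words_value; elim: cs cur st => [|c cs IHcs] cur st stl.
  case: st stl => [|[[f args] before] st] _ /=.
    by rewrite big_seq1 (mom_op_letter _ yE).
  by rewrite big_nil cut1_nil.
have IH1 st' : stack_lin st' -> words_value (size st') (1 * c) st' cs = stack_value st' c cs.
  by move=> stl'; rewrite -[in RHS](mul1r c); exact: IHcs.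
rewrite big_words /=.
case: st stl => [_|[[f args] before] st stl] /=.
  rewrite addr0 -[RHS]/(stack_value [::] cur (c :: cs)) stack_value_nil /allowed /=.
  by case: ifP => // _; congr (_ + _); [exact: (IHcs _ [::]) | exact: (IH1 [:: _])].
rewrite -[RHS]/(stack_value ((f, args, before) :: st) cur (c :: cs)) stack_value_frame //.
case: (stl) => fl stl'; rewrite /allowed /=.
congr (_ + _); last by congr (_ + _); [exact: (IH1 (_ :: _)) | exact: IHcs].
by case: ifP => // _; congr (_ + _); [exact: (IHcs _ (_ :: _)) | exact: (IH1 [:: _, _ & _])].
Qed.

End Reading.

(** * Sums over non-crossing partitions *)

Section Symbols.
Variable n : nat.
Implicit Types (P : {set {set 'I_n}}) (i j : 'I_n).

(** The letter of a point, read off from its block instead of the sequence of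
    blocks. *)
Definition letter_at P i : letter :=
  ([exists j in pblock P i, (j < i)%N], [exists j in pblock P i, (i < j)%N]).

Lemma word_letters P : partition P [set: 'I_n] ->
  word P = [seq letter_at P i | i <- enum 'I_n].
Proof.
move=> pP; suff H r s : rev r ++ s = enum 'I_n ->
    profile (map (pblock P) r) (map (pblock P) s) = map (letter_at P) s by exact: (H [::]).
elim: s r => //= i s IHs r rs; have := IHs (i :: r); rewrite rev_cons cat_rcons => /= -> //.
have idx j : index j (rev r ++ i :: s) = j by rewrite rs index_enum_ord.
have uq : uniq (rev r ++ i :: s) by rewrite rs enum_uniq.
have all j : j \in rev r ++ i :: s by rewrite rs mem_enum.
move: uq; rewrite cat_uniq /= => /and3P[_ /norP[ir /hasPn rs'] /andP[is_ _]].
have ri : size (rev r) = i.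
  by have := idx i; rewrite index_cat (negPf ir) /= eqxx addn0.
have lr j : (j < i)%N = (j \in r).
  rewrite -[RHS]mem_rev -[in LHS](idx j) index_cat -ri.
  by case: ifP => jr; [rewrite index_mem | rewrite ltnNge leq_addr].
have ls j : (i < j)%N = (j \in s).
  rewrite -[X in (_ < X)%N](idx j) index_cat -ri.
  have := all j; rewrite mem_cat inE; case: ifP => [jr _|jr /=].
    rewrite ltnNge ltnW ?index_mem //=; apply/esym/negbTE.
    by apply: contraTN jr => /rs'.
  rewrite -[X in (X < _)%N]addn0 ltn_add2l [i == j]eq_sym; case: eqP => [->|_ /= ->] //.
  by rewrite (negPf is_).
congr ((_, _) :: _).
  apply/mapP/exists_inP => -[j]; first rewrite -lr => ji e.
    by exists j; rewrite ?labelled_pblock // e.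
  by rewrite labelled_pblock // => /eqP e; rewrite lr => jr; exists j.
apply/mapP/exists_inP => -[j]; first rewrite -ls => ji e.
  by exists j; rewrite ?labelled_pblock // e.
by rewrite labelled_pblock // => /eqP e; rewrite ls => jr; exists j.
Qed.

Variables (K : fieldType) (B : algType K).

Lemma block_symbol_letter (S : {set 'I_n} -> bseries B) P i :
  partition P [set: 'I_n] ->
  block_symbol S P i = letter_symbol (S (pblock P i)) (letter_at P i).
Proof.
move=> pP; rewrite /block_symbol /letter_at.
have iP : i \in pblock P i by rewrite labelled_pblock.
have E1 : [forall j in pblock P i, (i <= j)%N] = ~~ [exists j in pblock P i, (j < i)%N].
  by rewrite negb_exists_in; apply: eq_forallb_in => j _; rewrite leqNgt.
have E2 : [forall j in pblock P i, (j <= i)%N] = ~~ [exists j in pblock P i, (i < j)%N].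
  by rewrite negb_exists_in; apply: eq_forallb_in => j _; rewrite leqNgt.
have E3 : (pblock P i == [set i]) = ~~ [exists j in pblock P i, (j < i)%N] &&
    ~~ [exists j in pblock P i, (i < j)%N].
  rewrite -E1 -E2; apply/eqP/andP => [->|[/forall_inP ge /forall_inP le]].
    by split; apply/forall_inP => j; rewrite inE => /eqP->.
  apply/setP => j; rewrite inE; apply/idP/eqP => [jP|->//].
  by apply/val_inj/eqP; rewrite /= eqn_leq le ?ge.
by rewrite E3 E1 E2; case: existsP => _; case: existsP.
Qed.

Lemma nested_word (F : bseries B) P bs : partition P [set: 'I_n] ->
  nested F P bs = read_string (interleave (map (letter_symbol F) (word P)) bs).
Proof.
move=> pP; rewrite word_letters // -map_comp; congr (read_string (interleave _ _)).
by apply: eq_map => i; exact: block_symbol_letter.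
Qed.

End Symbols.

Section NestedSums.
Variables (K : fieldType) (B : algType K).
Local Notation series := (bseries B).
Implicit Types (F x y : series).

Lemma read_rcons (ws : seq (symbol B)) bs cur st : size ws = (size bs).+1 ->
  (foldl (@read_symbol K B) (cur, st) (interleave ws (rcons bs 1))).1 =
  (foldl (@read_symbol K B) (cur, st) (interleave ws bs)).1.
Proof.
move=> sz; have -> : interleave ws (rcons bs 1) = rcons (interleave ws bs) (SCoef 1).
  elim: bs ws sz => [|b bs IHbs] [|w ws] //; first by case: ws.
  case: ws => // w' ws [sz].
  by rewrite (_ : interleave [:: w, w' & ws] (rcons (b :: bs) 1) =
      [:: w, SCoef b & interleave (w' :: ws) (rcons bs 1)]) // IHbs /= ?sz.
by rewrite foldl_rcons; case: foldl => a [|[[f args] bef] s] /=; rewrite mulr1.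
Qed.

Lemma sum_words_read o i F x y bs : multilinear F ->
  x = mom_op (gate i (comps F x)) x -> y = mom_op (gate o (comps F x)) y ->
  \sum_(w <- words o i 0 (size bs).+1)
     read_string (interleave (map (letter_symbol F) w) bs) = y (1 :: rcons bs 1).
Proof.
move=> Fl xE yE.
have : words_value o i F 0 1 [::] (rcons bs 1) = y (1 :: rcons bs 1).
  exact: (words_valueE Fl xE yE (st := [::])).
rewrite /words_value size_rcons => <-; apply: eq_big_seq => w.
by rewrite mem_words => /andP[/eqP sw _]; rewrite read_rcons // size_map.
Qed.

(** The moments are the fixed point of x = I + I (F o x) x, where F o x collects the
    partitions whose block of the first point also contains the last one. *)
Lemma sum_NC F x bs : multilinear F -> x = mom_op (comps F x) x ->
  \sum_(P in NC (size bs).+1) nested F P bs = x (1 :: rcons bs 1).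
Proof.
move=> Fl xE; rewrite -(sum_words_read (o := true) (i := true) bs Fl xE xE).
rewrite -big_NC; apply: eq_bigr => P; rewrite inE => /andP[pP _].
exact: nested_word.
Qed.

(** The series I; it is the moment series of the vanishing B-transform. *)
Definition letter1 : series := fun w => if w is [:: c] then c else 0.

Lemma letter1E : letter1 = mom_op (fun _ => 0) letter1.
Proof.
apply/funext => -[|c w] //=; rewrite /prods (eq_cut _ (psi := fun _ _ => 0)).
  by rewrite cut0 addr0; case: w => [|d w]; rewrite ?mulr1 ?mulr0.
by move=> u v; rewrite mul0r.
Qed.

Lemma comps_letter1 F : multilinear F -> comps F letter1 = F.
Proof.
move=> Fl; apply/funext => w; elim: w F Fl => [|a w IHw] F Fl; first exact: comps_nil.
rewrite comps_cons cut_first; first exact/IHw/multilinear_partial.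
by move=> u d v; exact: comps_partial0.
Qed.

(** Nothing may be nested in a block of an interval partition, so the arguments
    of the blocks are evaluated by I. *)
Lemma sum_IntNC F y bs : multilinear F -> y = mom_op F y ->
  \sum_(P in IntNC (size bs).+1) nested F P bs = y (1 :: rcons bs 1).
Proof.
move=> Fl yE; have yE' : y = mom_op (gate true (comps F letter1)) y.
  by rewrite /gate comps_letter1.
rewrite -(sum_words_read (o := true) (i := false) bs Fl letter1E yE').
rewrite -big_IntNC; apply: eq_bigr => P; rewrite inE => /andP[].
by rewrite inE => /andP[pP _] _; exact: nested_word.
Qed.

(** Only openings and singletons carry a functional, and the outer block has no
    opening except at the first point. *)
Lemma nested_outer_word n F G (P : {set {set 'I_n.+1}}) bs :
  partition P [set: 'I_n.+1] ->
  nested_col F G P (fun V => V == outer_block P) bs =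
  if word P is a :: w then
    read_string (interleave (letter_symbol F a :: map (letter_symbol G) w) bs) else 0.
Proof.
move=> pP; rewrite /nested_col /nested_by word_letters // enum_ordSl [map (letter_at P) _]/=.
congr (read_string (interleave _ _)).
rewrite [LHS]/= block_symbol_letter // eqxx; congr (_ :: _).
rewrite -!map_comp; apply: eq_map => i /=; rewrite block_symbol_letter //.
case: ifP => // /eqP e; rewrite /letter_at.
suff -> : [exists j in pblock P (lift ord0 i), (j < lift ord0 i)%N] by case: ifP.
by apply/exists_inP; exists ord0; rewrite // e /outer_block labelled_pblock.
Qed.

(** The blocks strictly inside the outer block fill the gaps between its points,
    and all of them use [alpha \o F]: their sum over one gap is a moment of the
    distribution with that R-transform. *)
Lemma RBhat_comps (alpha : {linear B -> B}) F x : multilinear F ->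
  x = mom_op (comps (alpha \o F) x) x -> RBhat alpha F = comps F x.
Proof.
move=> Fl xE; have Gl : multilinear (alpha \o F).
  by move=> u v c a b; rewrite /= Fl linearP.
apply/funext => bs; rewrite /RBhat.
pose phi (w : seq letter) := if w is a :: w' then
  read_string (interleave (letter_symbol F a :: map (letter_symbol (alpha \o F)) w') bs) else 0.
transitivity (\sum_(w <- outer_words (size bs)) phi w).
  rewrite -big_outer; apply: eq_bigr => P /andP[]; rewrite inE => /andP[pP _] _.
  exact: nested_outer_word.
case: bs @phi => [|b bs] phi.
  by rewrite /= big_seq1 /phi /read_string /= mul1r comps_nil.
rewrite -[outer_words _]/[seq (false, true) :: w | w <- words false true 1 (size bs).+1].
rewrite big_map.
have : words_value false true (alpha \o F) 1 b [:: (F, [::], 1)] (rcons bs 1) =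
    cut1 (fun u t v => letter1 (1 * comps F x (b :: u) * t :: v)) (rcons bs 1).
  exact: (words_valueE (o := false) (i := true) Gl xE letter1E
    (st := [:: (F, [::], 1)]) b (rcons bs 1) (conj Fl I)).
rewrite /words_value size_rcons => E; rewrite [RHS](_ : _ = cut1
  (fun u t v => letter1 (1 * comps F x (b :: u) * t :: v)) (rcons bs 1)).
  rewrite -E; apply: eq_big_seq => w.
  rewrite mem_words => /andP[/eqP sw _]; rewrite read_rcons ?size_map //.
  by rewrite /phi /read_string /= mul1r.
rewrite /cut1 cut_rcons addr0 cut_last => [|u a v]; last by case: v.
by rewrite /= mul1r mulr1.
Qed.

End NestedSums.

(** * Subordination *)

Section Subordination.
Variables (K : fieldType) (B : algType K) (alpha : {linear B -> B}).
Local Notation series := (bseries B).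
Implicit Types (F r m k x y : series).

Lemma free_mom_unique F x y :
  x = mom_op (comps F x) x -> y = mom_op (comps F y) y -> x = y.
Proof. exact: (contractive_unique (mom_op_contractive (@comps_causal _ _ F))). Qed.

(** A series with a single nonzero term, of one argument, only sees the
    decomposition into one piece. *)
Lemma semicircular_comps x : x [::] = 0 ->
  comps (semicircular_series alpha) x = alpha \o x.
Proof.
move=> x0; apply/funext => -[|a w]; first by rewrite comps_nil /= x0 linear0.
rewrite comps_cons cut_last => [|u d v]; first by rewrite comps_nil.
rewrite comps_cons; apply: big1 => k _; exact: big1.
Qed.

(** Subordination. Adding to the R-transform [r] of [m] a series whose composition
    with the moments is [alpha \o x], as a semicircular element does, amounts to
    substituting [k] in [m]: both [x] and [comps m k] solve
    y = I + I (alpha x + r o y) y. *)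
Lemma comps_subordination r m x k : multilinear r ->
  m = mom_op (comps r m) m -> x = mom_op ((alpha \o x) \+ comps r x) x ->
  k = mom_op (alpha \o x) k -> x = comps m k.
Proof.
move=> rl mE xE kE; have k0 := mom_op_nil kE.
have cE := mom_op_comps k0 mE; rewrite -compsA // in cE.
have opc := mom_op_contractive (causalD (alpha \o x) (@comps_causal _ _ r)).
exact: (contractive_unique opc xE (mom_op_resolvent kE cE)).
Qed.

(** Here [n] and [n'] are the moments with R-transforms [F] and F o rho, and [T] is
    the B-transform of [n']. With s = rho o n', the resolvent identity applied to
    the equations of rho and n' gives s = I + I (T + alpha T) s, where T = F o s; and
    n o k solves the same equation because of that of [n]. So s = n o k
    and T = F o s = (F o n) o k. *)
Lemma comps_Boolean F n rho n' k : multilinear F ->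
  n = mom_op (comps F n) n -> rho = mom_op (comps (alpha \o F) rho) rho ->
  n' = mom_op (comps (comps F rho) n') n' ->
  let T := comps (comps F rho) n' in
  k = mom_op (alpha \o T) k -> T = comps (comps F n) k.
Proof.
move=> Fl nE rhoE n'E T kE; rewrite -/T in n'E.
set s := comps rho n'.
have TE : T = comps F s by rewrite /s compsA.
have sE : s = mom_op ((alpha \o T) \+ comps F s) s.
  have sE := mom_op_comps (mom_op_nil n'E) rhoE.
  rewrite comps_linear comps_linear -/T -/s in sE.
  have -> : (alpha \o T) \+ comps F s = T \+ (alpha \o T).
    by rewrite -TE; apply/funext => w /=; rewrite addrC.
  exact: mom_op_resolvent n'E sE.
rewrite -compsA // {1}TE; congr comps.
have cE := mom_op_comps (mom_op_nil kE) nE; rewrite -compsA // in cE.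
have opc := mom_op_contractive (causalD (alpha \o T) (@comps_causal _ _ F)).
exact: (contractive_unique opc sE (mom_op_resolvent kE cE)).
Qed.

End Subordination.

(** * Distributions and their transforms *)

Section Transforms.
Variables (K : fieldType) (B : algType K).
Local Notation series := (bseries B).
Implicit Types (F f g m x y : series) (mu nu : algdist B) (w bs : seq B).

Lemma multilinear_add f g : multilinear f -> multilinear g -> multilinear (f \+ g : series).
Proof. by move=> fl gl u v c a b /=; rewrite fl gl scalerDr addrACA. Qed.

Lemma multilinear_opp f : multilinear f -> multilinear (fun w => - f w : B).
Proof. by move=> fl u v c a b /=; rewrite fl opprD scalerN. Qed.

Lemma multilinear_rcons f a : multilinear f -> multilinear (fun w => f (rcons w a) : B).
Proof. by move=> fl u v c b b' /=; rewrite !rcons_cat /= fl. Qed.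

Lemma multilinear_linear (alpha : {linear B -> B}) f : multilinear f -> multilinear (alpha \o f).
Proof. by move=> fl u v c a b /=; rewrite fl linearP. Qed.

Lemma ncCE (c : K) (a b : B) : ncC (c *: a + b) = c *: ncC a + ncC b.
Proof.
rewrite [LHS]ncpoly_coefD; congr (ncpoly_add _ _).
by rewrite -[c *: a]mul1r -scalerAr scalerAl [LHS]ncpoly_coefM.
Qed.

Lemma Phi_series_multilinear mu : multilinear (Phi_series mu).
Proof.
have monl u v b0 : linear (fun b : B => monomX b0 (u ++ b :: v)).
  move=> c a b; elim: u b0 => [|d u IHu] b0 /=; last by rewrite IHu mulrDr scalerAr.
  case: v => [|e v] /=; first by rewrite ncCE mulrDr -scalerAr.
  by rewrite ncCE !mulrDl mulrDr -!scalerAl -scalerAr.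
move=> [|b0 u] v c a b; last by rewrite /= monl linearP.
by case: v => [|e v] /=; rewrite ncCE ?mulrDl -?scalerAl linearP.
Qed.

Lemma Phi_series_letter mu a : Phi_series mu [:: a] = a.
Proof. exact: algdist_coef. Qed.

Lemma Phi_series_moments mu a w c :
  Phi_series mu (a :: rcons w c) = a * moments mu w * c.
Proof.
rewrite /= /moments -algdist_bimod; congr (mu _).
by elim: w a => [|b w IHw] a //=; rewrite IHw !mulrA.
Qed.

Lemma mom_op_rmul b x w a c : x = mom_op b x -> x (rcons w (a * c)) = x (rcons w a) * c.
Proof.
move=> xE; have [n] := ubnP (size w); elim: n w => // n IHn [|d w] /ltnSE sw /=.
  by rewrite !(mom_op_letter _ xE).
rewrite xE /= /prods !cut_rcons (mom_op_nil xE) !mulr0 !addr0.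
rewrite /nilp !size_rcons !add0r -mulrA cut_mulr; congr (_ * _).
apply: eq_cut_in => u v wuv; rewrite IHn ?mulrA //.
by apply: leq_trans sw; rewrite wuv /= size_cat ltnS leq_addl.
Qed.

Lemma mom_op_moments b x a w c : x = mom_op b x ->
  x (a :: rcons w c) = a * x (1 :: rcons w 1) * c.
Proof.
move=> xE; rewrite -{1}[a]mulr1 -{1}[c]mul1r (mom_op_lmul _ _ _ xE) -mulrA.
by rewrite -rcons_cons (mom_op_rmul _ _ _ xE).
Qed.

(** Both sides are homogeneous in the first and in the last letter, so that it
    suffices to compare them where these letters are 1. *)
Lemma Phi_series_eq_mom mu b x : x = mom_op b x ->
  (forall w, moments mu w = x (1 :: rcons w 1)) -> Phi_series mu = x.
Proof.
move=> xE mx; apply/funext => -[|a w]; first by rewrite (mom_op_nil xE).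
case/lastP: w => [|w c]; first by rewrite Phi_series_letter (mom_op_letter _ xE).
by rewrite Phi_series_moments mx (mom_op_moments _ _ _ xE).
Qed.

Lemma moments_Phi_series mu w : moments mu w = Phi_series mu (1 :: rcons w 1).
Proof. by rewrite Phi_series_moments mul1r mulr1. Qed.

(** [Phi_series mu] consists of the values of [mu] at the monomials; it extends the
    moments by a coefficient at either end, and its fixed point equation replaces
    the sum over partitions. *)
Lemma Rtransform_mom mu F : is_Rtransform mu F <->
  multilinear F /\ Phi_series mu = mom_op (comps F (Phi_series mu)) (Phi_series mu).
Proof.
split=> [[Fl mF]|[Fl mE]]; split=> //; last first.
  by move=> bs; rewrite (sum_NC _ Fl mE) moments_Phi_series.
have opc : contractive (fun x : series => mom_op (comps F x) x).
  exact/mom_op_contractive/comps_causal.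
have xE := sfixE opc.
rewrite (Phi_series_eq_mom xE) // => w.
by rewrite mF (sum_NC _ Fl xE).
Qed.

Lemma mom_contractive (b : series) : contractive (mom_op b).
Proof. exact: (@mom_op_contractive _ _ (fun=> b)). Qed.

Lemma Btransform_mom mu F : is_Btransform mu F <->
  multilinear F /\ Phi_series mu = mom_op F (Phi_series mu).
Proof.
split=> [[Fl mF]|[Fl mE]]; split=> //; last first.
  by move=> bs; rewrite (sum_IntNC _ Fl mE) moments_Phi_series.
have xE := sfixE (@mom_contractive F).
rewrite (Phi_series_eq_mom xE) // => w.
by rewrite mF (sum_IntNC _ Fl xE).
Qed.

(** Written in this form, the equation for the B-transform becomes contractive. *)
Lemma prods_eq_fix g m f :
  (forall w, prods f m (rcons w 1) = g w) <->
  f = g \+ (fun w => f w - prods f m (rcons w 1)).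
Proof.
split=> [E|E w]; first by apply/funext => w; rewrite /= E addrC subrK.
have /eqP := congr1 (fun h => h w) E; rewrite /= addrCA -[X in X == _]addr0 => /eqP/addrI/eqP.
by rewrite eq_sym subr_eq0 => /eqP.
Qed.

Lemma comps_eq_fix g m f :
  comps f m = g <-> f = g \+ (fun w => f w - comps f m w).
Proof.
split=> [E|E]; first by apply/funext => w; rewrite /= E addrC subrK.
apply/funext => w.
have /eqP := congr1 (fun h => h w) E; rewrite /= addrCA -[X in X == _]addr0 => /eqP/addrI/eqP.
by rewrite eq_sym subr_eq0 => /eqP.
Qed.

(** The uniqueness of the B-transform. *)
Lemma mom_op_inj b b' m : m = mom_op b m -> m = mom_op b' m -> b = b'.
Proof.
move=> mE mE'; have m0 := mom_op_nil mE; have m1 a := mom_op_letter a mE.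
pose g w := m (1 :: rcons w 1).
have fE f : m = mom_op f m -> f = g \+ (fun w => f w - prods f m (rcons w 1)).
  move=> E; apply/prods_eq_fix => w; rewrite /g {2}E /= /nilp size_rcons.
  by rewrite add0r mul1r.
have opc := contractive_addl g (prods_contractive m0 m1).
exact: contractive_unique opc (fE _ mE) (fE _ mE').
Qed.

Lemma comps_inj f f' m : (forall a, m [:: a] = a) -> comps f m = comps f' m -> f = f'.
Proof.
move=> m1 E; have opc := contractive_addl (comps f' m) (comps_contractive m1).
by apply: contractive_unique opc _ _; exact/comps_eq_fix.
Qed.

Lemma Btransform_exists mu : exists F, is_Btransform mu F.
Proof.
set m := Phi_series mu; have m1 a : m [:: a] = a by exact: Phi_series_letter.
pose g w := m (1 :: rcons w 1).
have ml : multilinear m by exact: Phi_series_multilinear.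
have gl : multilinear g by exact/(@multilinear_rcons (partial 1 m))/multilinear_partial.
pose op (f : series) := g \+ (fun w => f w - prods f m (rcons w 1)).
have opc : contractive op by exact/contractive_addl/prods_contractive.
exists (sfix op); apply/Btransform_mom; split.
  apply: sfix_multilinear => // f fl; apply: multilinear_add => //.
  apply: multilinear_add => //; apply: multilinear_opp.
  exact/(multilinear_rcons (f := prods f m))/prods_multilinear.
have /prods_eq_fix fE : sfix op = op (sfix op) by exact: sfixE.
apply/funext => -[|a w] //.
case/lastP: w => [|w c].
  by rewrite Phi_series_letter /= prods_nil mulr0 addr0 mulr1.
rewrite Phi_series_moments moments_Phi_series -/m -/(g w) -fE.
rewrite /mom_op /nilp size_rcons add0r -mulrA; congr (_ * _).
rewrite /prods !cut_rcons !mulr0 !addr0 cut_mulr; apply: eq_cut => u v.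
rewrite -mulrA; congr (_ * _); case: v => [|d v]; first by rewrite !m1 mul1r.
by rewrite !rcons_cons /m !Phi_series_moments mulr1.
Qed.

Lemma Rtransform_exists mu : exists F, is_Rtransform mu F.
Proof.
have [b /Btransform_mom[bl bE]] := Btransform_exists mu.
set m := Phi_series mu in bE; have m1 a : m [:: a] = a by exact: Phi_series_letter.
have ml : multilinear m by exact: Phi_series_multilinear.
pose op (f : series) := b \+ (fun w => f w - comps f m w).
have opc : contractive op by exact/contractive_addl/comps_contractive.
exists (sfix op); apply/Rtransform_mom; split.
  apply: sfix_multilinear => // f fl; apply: multilinear_add => //.
  apply: multilinear_add => //; apply: multilinear_opp.
  exact/comps_multilinear.
by have /comps_eq_fix -> : sfix op = op (sfix op) by exact: sfixE.
Qed.

Lemma Rtransform_unique mu F F' : is_Rtransform mu F -> is_Rtransform mu F' -> F = F'.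
Proof.
move=> /Rtransform_mom[_ E] /Rtransform_mom[_ E'].
exact: comps_inj (Phi_series_letter mu) (mom_op_inj E E').
Qed.

Lemma Btransform_unique mu F F' : is_Btransform mu F -> is_Btransform mu F' -> F = F'.
Proof. by move=> /Btransform_mom[_ E] /Btransform_mom[_ E']; exact: mom_op_inj E E'. Qed.

Lemma RtransformP mu : is_Rtransform mu (Rtransform mu).
Proof.
rewrite /Rtransform.
exact: (classical_sets.xgetPex (P := is_Rtransform mu) _ (Rtransform_exists mu)).
Qed.

Lemma BtransformP mu : is_Btransform mu (Btransform mu).
Proof.
exact: (classical_sets.xgetPex (P := is_Btransform mu) _ (Btransform_exists mu)).
Qed.

Lemma algdist_eq mu nu : Phi_series mu = Phi_series nu -> mu = nu.
Proof.
move=> E; have Emu : algdist_fun mu = algdist_fun nu.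
  have : algdist_fun mu =1 algdist_fun nu.
    by apply: monomX_span => b bs; exact: (congr1 (fun f => f (b :: bs)) E).
  move/funext; case: (algdist_fun mu) => f cf; case: (algdist_fun nu) => g cg /= fg.
  subst g; congr GRing.Linear.Pack.
  case: cf cg => [[p] [q]] [[p'] [q']].
  by rewrite (Prop_irrelevance p p') (Prop_irrelevance q q').
case: mu nu Emu {E} => f p q [g p' q'] /= fg; subst g.
by congr Algdist; exact: Prop_irrelevance.
Qed.

Lemma monomX_mull (a d : B) bs : ncC a * monomX d bs = monomX (a * d) bs.
Proof. by case: bs => [|e bs] /=; rewrite ?mulrA [ncC (a * d)]ncpoly_coefM. Qed.

Lemma monomX_mulr (d e c : B) bs :
  monomX d (rcons bs e) * ncC c = monomX d (rcons bs (e * c)).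
Proof.
elim: bs d => [|b bs IHbs] d /=; last by rewrite -IHbs mulrA.
by rewrite -mulrA [ncC (e * c)]ncpoly_coefM.
Qed.

(** The fixed point equation gives homogeneity in the first letter at once, and in
    the last letter by induction; this is the bimodule property. *)
Lemma algdist_of_mom b x : multilinear x -> x = mom_op b x ->
  exists mu, Phi_series mu = x.
Proof.
move=> xl xE; have [L LE] := monomX_extend xl.
have coefL a : L (ncC a) = a by rewrite (LE a [::]) (mom_op_letter _ xE).
have bimodL (a : B) (p : ncpoly B) (c : B) : L (ncC a * p * ncC c) = a * L p * c.
  pose f p := L (ncC a * p * ncC c); pose g p := a * L p * c.
  have fl : linear f by move=> k s t; rewrite /f mulrDr mulrDl -scalerAr -scalerAl linearP.
  have gl : linear g by move=> k s t; rewrite /g linearP mulrDr mulrDl -scalerAr -scalerAl.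
  pose fm := GRing.isLinear.Build K (ncpoly B) B _ f fl.
  pose gm := GRing.isLinear.Build K (ncpoly B) B _ g gl.
  pose f' : {linear ncpoly B -> B} := HB.pack f fm.
  pose g' : {linear ncpoly B -> B} := HB.pack g gm.
  apply: (monomX_span (L := f') (L' := g')) p => d bs; rewrite /f' /g' /= /f /g.
  rewrite monomX_mull; case/lastP: bs => [|bs e].
    by rewrite -[monomX _ _ * _]ncpoly_coefM coefL (LE _ [::]) (mom_op_letter _ xE).
  rewrite monomX_mulr !LE (mom_op_lmul _ _ _ xE) -mulrA; congr (_ * _).
  by rewrite -!rcons_cons (mom_op_rmul _ _ _ xE).
exists (Algdist bimodL coefL); apply/funext => -[|a w]; first by rewrite (mom_op_nil xE).
exact: LE.
Qed.

Lemma algdist_of_RP F : multilinear F -> is_Rtransform (algdist_of_R F) F.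
Proof.
move=> Fl; have opc : contractive (fun x : series => mom_op (comps F x) x).
  exact/mom_op_contractive/comps_causal.
have xE := sfixE opc; set x := sfix _ in xE.
have xl : multilinear x.
  apply: sfix_multilinear => // y yl; apply: mom_op_multilinear => //.
  exact: comps_multilinear.
have [mu muE] := algdist_of_mom xl xE.
have muF : Rtransform mu = F.
  by apply: (Rtransform_unique (RtransformP mu)); apply/Rtransform_mom; rewrite muE.
have {2}<- : Rtransform (algdist_of_R F) = F; last exact: RtransformP.
apply: (classical_sets.xgetPex (P := fun mu => Rtransform mu = F) _).
by exists mu.
Qed.

Lemma algdist_of_BP F : multilinear F -> is_Btransform (algdist_of_B F) F.
Proof.
move=> Fl; have xE := sfixE (@mom_contractive F); set x := sfix _ in xE.
have xl : multilinear x.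
  by apply: sfix_multilinear => [|y yl]; [exact: mom_contractive | exact: mom_op_multilinear].
have [mu muE] := algdist_of_mom xl xE.
have muF : Btransform mu = F.
  by apply: (Btransform_unique (BtransformP mu)); apply/Btransform_mom; rewrite muE.
have {2}<- : Btransform (algdist_of_B F) = F; last exact: BtransformP.
apply: (classical_sets.xgetPex (P := fun mu => Btransform mu = F) _).
by exists mu.
Qed.

Lemma algdist_of_B_unique mu F : is_Btransform mu F -> algdist_of_B F = mu.
Proof.
move=> BmuF; have Fl : multilinear F by case: BmuF.
have /Btransform_mom[_ E] := algdist_of_BP Fl; have /Btransform_mom[_ E'] := BmuF.
exact/algdist_eq/(contractive_unique (@mom_contractive F) E E').
Qed.

Lemma Rtransform_algdist_of_R F : multilinear F -> Rtransform (algdist_of_R F) = F.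
Proof. by move=> Fl; exact: Rtransform_unique (RtransformP _) (algdist_of_RP Fl). Qed.

Lemma semicircular_multilinear (alpha : {linear B -> B}) :
  multilinear (semicircular_series alpha).
Proof.
move=> u v c a b; rewrite /semicircular_series.
case: u => [|d [|e u]] /=; last by rewrite scaler0 addr0.
  by case: v => [|e v]; rewrite ?linearP // scaler0 addr0.
by rewrite scaler0 addr0.
Qed.

(** Both B-transforms, that of the left-hand side by subordination and that of the
    right-hand side by [comps_Boolean], have the form [comps (Phi_series beta) k]
    where [k] solves k = I + I (alpha o [Phi_series beta] o k) k. *)
Lemma Phi_boxplus_semicircular (alpha : {linear B -> B}) (beta : algdist B) :
  Phi (boxplus beta (semicircular alpha)) = BB alpha (Phi beta).
Proof.
have sl := semicircular_multilinear alpha.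
rewrite /boxplus /BB Rtransform_algdist_of_R //.
have /Rtransform_mom[rl rE] := RtransformP beta; set r := Rtransform beta in rl rE *.
set bt' := algdist_of_R (r \+ _).
have /Rtransform_mom[_ bE] := algdist_of_RP (multilinear_add rl sl).
rewrite -/bt' in bE; set m' := Phi_series bt' in bE.
have nB : is_Btransform (Phi beta) (Phi_series beta).
  exact/algdist_of_BP/Phi_series_multilinear.
have /Btransform_mom[_ nBE] := nB.
have /Rtransform_mom[Fl nE] := RtransformP (Phi beta).
set F := Rtransform _ in Fl nE *; set n := Phi_series (Phi beta) in nBE nE.
have Fn : comps F n = Phi_series beta by exact: mom_op_inj nE nBE.
have Gl : multilinear (alpha \o F) by exact: multilinear_linear.
have opc : contractive (fun x : series => mom_op (comps (alpha \o F) x) x).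
  exact/mom_op_contractive/comps_causal.
have rhoE := sfixE opc; set rho := sfix _ in rhoE.
have rhol : multilinear rho.
  apply: sfix_multilinear => // y yl; apply: mom_op_multilinear => //.
  exact: comps_multilinear.
rewrite (RBhat_comps Fl rhoE).
have F'l := comps_multilinear Fl rhol; set nu' := algdist_of_R _.
have /Rtransform_mom[_ n'E] := algdist_of_RP F'l; rewrite -/nu' in n'E.
set n' := Phi_series nu' in n'E.
set T := comps (comps F rho) n' in n'E.
apply: algdist_of_B_unique; apply/Btransform_mom; split; first exact: Phi_series_multilinear.
suff -> : Phi_series bt' = T by [].
have kE := sfixE (@mom_contractive (alpha \o T)); set k := sfix _ in kE.
have kE' := sfixE (@mom_contractive (alpha \o m')); set k' := sfix _ in kE'.
have TE : T = comps (Phi_series beta) k.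
  by rewrite -Fn; exact: comps_Boolean Fl nE rhoE n'E kE.
have m'E : m' = comps (Phi_series beta) k'.
  apply: comps_subordination rl rE _ kE'.
  rewrite {1}bE compsD semicircular_comps ?(mom_op_nil bE) //; congr mom_op.
  by apply/funext => w /=; rewrite addrC.
rewrite -/m' m'E TE; congr comps.
apply: (free_mom_unique (F := alpha \o Phi_series beta)).
  by rewrite comps_linear -m'E.
by rewrite comps_linear -TE.
Qed.

End Transforms.

Theorem theorem6p9 (R : realType) (B : cstarAlgType R)
    (alpha : {linear B -> B}) (beta : algdist B) :
  Phi (boxplus beta (semicircular alpha)) = BB alpha (Phi beta).
Proof. exact: Phi_boxplus_semicircular. Qed.
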